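(* Let $X_{min}\subset \mathrm{Gr}(3,\mathbb{I})$ be the equivariant compactification of $G_2/SO_4$ given by the Zariski closure of the orbit $G_2\cdot W_0\cong G_2/SO_4$ in $\mathrm{Gr}(3,\mathbb{I})$. Then, as a subvariety of $\mathrm{Gr}(3,\mathbb{I})$, $X_{min}$ is defined by the vanishing of the following seven linear forms in the Plücker coordinates $p_{ijk}$ of $\mathrm{Gr}(3,\mathbb{I})$ (with respect to the basis $e_1,\dots,e_7$ of $\mathbb{I}$): 1. $p_{247} - p_{256} - p_{346} - p_{357}$, 2. $p_{156} - p_{147} + p_{345} - p_{367}$, 3. $-p_{245} + p_{267} + p_{146} + p_{157}$, 4. $p_{567} + p_{127} - p_{136} + p_{235}$, 5. $-p_{126} - p_{467} - p_{137} - p_{234}$, 6. $p_{457} + p_{125} + p_{134} - p_{237}$, 7. $p_{135} - p_{124} - p_{456} + p_{236}$.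
   Context: Let $\mathbb{D}=\mathrm{Mat}_2(\mathbb{C})$ be the algebra of complex $2\times 2$ matrices, with norm $N(a)=\det a$ and conjugation $\bar a=\mathrm{tr}(a)\cdot 1-a$. The complex octonion algebra is $\mathbb{O}=\mathbb{D}\oplus\mathbb{D}$ with product $(a,b)(c,d)=(ac+\bar d b,\ da+b\bar c)$, norm $N((a,b))=\det a-\det b$, and identity $e=(1,0)$. $G_2$ is the group of $\mathbb{C}$-algebra automorphisms of $\mathbb{O}$. $\mathbb{I}=e^{\perp}$ is the orthogonal complement of $e$ with respect to the bilinear form of $N$; it is the 7-dimensional space $\mathfrak{sl}_2(\mathbb{C})\oplus \mathrm{Mat}_2(\mathbb{C})$, and $G_2$ acts on it. Put $\mathbf{i}=\begin{pmatrix} i&0\\0&-i\end{pmatrix}$, $\mathbf{j}=\begin{pmatrix}0&1\\-1&0\end{pmatrix}$, $\mathbf{k}=\begin{pmatrix}0&i\\ i&0\end{pmatrix}$. The basis of $\mathbb{I}$ is $e_1=(\mathbf{i},0)$, $e_2=(\mathbf{j},0)$, $e_3=(\mathbf{k},0)$, $e_4=(0,1)$, $e_5=(0,\mathbf{i})$, $e_6=(0,\mathbf{j})$, $e_7=(0,\mathbf{k})$. $W_0$ is the span of $e_1,e_2,e_3$, i.e. $W_0=(\mathbb{D}\oplus 0)\cap\mathbb{I}$; its stabilizer in $G_2$ is isomorphic to $SO_4$. $\mathrm{Gr}(3,\mathbb{I})$ is the Grassmannian of 3-dimensional subspaces of $\mathbb{I}$, embedded in $\mathbb{P}(\bigwedge^3\mathbb{I})$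 by the Plücker embedding; $p_{ijk}$ ($i<j<k$) is the coordinate dual to $e_i\wedge e_j\wedge e_k$. *)

(* Defs.v *)
From HB Require Import structures.
From mathcomp Require Import all_boot all_order all_algebra.
From mathcomp Require Import complex.
From mathcomp Require Import reals.
From mathcomp Require Import mpoly.

Set Implicit Arguments.
Unset Strict Implicit.
Unset Printing Implicit Defensive.

Import GRing.Theory.
Local Open Scope ring_scope.
Local Open Scope complex_scope.

Section Octonions.
Variable R : realType.
Local Notation C := (R[i]).

Definition qconj (a : 'M[C]_2) : 'M[C]_2 := (\tr a)%:M - a.

Definition octonion : Type := ('M[C]_2 * 'M[C]_2)%type.

HB.instance Definition _ := Vector.on octonion.

Implicit Types x y : octonion.

Definition omul x y : octonion :=
  (x.1 *m y.1 + qconj y.2 *m x.2, y.2 *m x.1 + x.2 *m qconj y.1).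

Definition oone : octonion := (1%:M, 0).

Definition onorm x : C := \det x.1 - \det x.2.

Definition obilin x y : C := onorm (x + y) - onorm x - onorm y.

(* A bijective multiplicative map automatically fixes [oone]. *)
Definition isG2 (g : 'End(octonion)) : Prop :=
  bijective g /\ forall x y, g (omul x y) = omul (g x) (g y).

(* The imaginary octonions, i.e. the orthogonal complement of [oone]. *)
Definition imO : pred octonion := [pred x | obilin oone x == 0].

Local Notation im := ('i%C : C).

Definition qi : 'M[C]_2 := \matrix_(r, s)
  (if r == s then (if r == 0 then im else - im) else 0).
Definition qj : 'M[C]_2 := \matrix_(r, s)
  (if r == s then 0 else (if r == 0 then 1 else -1)).
Definition qk : 'M[C]_2 := \matrix_(r, s) (if r == s then 0 else im).

(* [tnth ebasis m] is the basis vector e_(m+1) of the imaginary octonions. *)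
Definition ebasis : 7.-tuple octonion :=
  [tuple (qi, 0); (qj, 0); (qk, 0); (0, 1%:M); (0, qi); (0, qj); (0, qk)].

Definition W0 : {vspace octonion} := <<take 3 ebasis>>%VS.

Definition Gr3 (W : {vspace octonion}) : Prop :=
  \dim W = 3%N /\ {subset W <= imO}.

Definition orbitW0 (W : {vspace octonion}) : Prop :=
  exists2 g : 'End(octonion), isG2 g & W = (g @: W0)%VS.

(* Homogeneous coordinates of the point spanned by [v] in the projective space *)
(* of the third exterior power: the 3 x 3 minors of the matrix whose rows are  *)
(* the coordinates of [v] in [ebasis].                                         *)
Definition plucker (v : 3.-tuple octonion) (t : 3.-tuple 'I_7) : C :=
  \det (\matrix_(r < 3, s < 3) coord ebasis (tnth t s) (tnth v r)).

(* The Plücker coordinate p_ijk, with indices running from 1 to 7. *)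
Definition pcoord (v : 3.-tuple octonion) (i j k : nat) : C :=
  plucker v [tuple inord i.-1; inord j.-1; inord k.-1].

(* The strictly increasing triples of indices, numbering the 35 homogeneous *)
(* coordinates.                                                             *)
Definition incr3 : predArgType :=
  {t : 3.-tuple 'I_7 | sorted ltn [seq val i | i <- t]}.

Definition pvec (v : 3.-tuple octonion) (m : 'I_#|{: incr3}|) : C :=
  plucker v (val (enum_val m)).

(* For homogeneous [F] the condition does not depend on the basis [v] of [W]. *)
Definition vanishes (F : {mpoly C[#|{: incr3}|]}) (W : {vspace octonion}) :
    Prop :=
  forall v : 3.-tuple octonion, basis_of W v -> F.@[pvec v] = 0.

(* Closed subsets of [Gr3] for the Zariski topology. *)
Definition zariski_closed (Z : {vspace octonion} -> Prop) : Prop :=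
  exists2 S : {mpoly C[#|{: incr3}|]} -> Prop,
    forall F, S F -> exists d : nat, F \is d.-homog &
    forall W, Z W <-> Gr3 W /\ forall F, S F -> vanishes F W.

Definition zariski_closure (A : {vspace octonion} -> Prop)
    (W : {vspace octonion}) : Prop :=
  forall Z, zariski_closed Z -> (forall V, A V -> Z V) -> Z W.

Definition Xmin : {vspace octonion} -> Prop := zariski_closure orbitW0.

End Octonions.

Arguments pcoord {R} v (i j k)%_N.

(* Main.v *)
Require Import Defs.
From HB Require Import structures.
From mathcomp Require Import all_boot all_order all_algebra.
From mathcomp Require Import complex boolp reals mpoly.
From mathcomp Require Import ssrAC ring.

Import GRing.Theory.
Local Open Scope ring_scope.

(** The seven linear forms are, up to factors 2 and -2, the coordinates of the
    associator (xy)z - x(yz) of a basis x, y, z of W ([forms_associator]).  A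
    change of basis multiplies all Plücker coordinates by one determinant, so
    the common zero locus of the forms in Gr(3, I) is the set of the planes on
    which the octonion product is associative; below it is called [cayley].

    This locus is closed by construction.  It contains the orbit of W0, since W0
    lies in the associative subalgebra of pairs (p, 0) and automorphisms respect
    both the product and I ([orbit_cayley]).

    For the converse, the main point is that every plane W of the locus, however
    degenerate the norm is on W, has the form <x, y, [x, y]> with x, y in W
    ([cayley_generated]).  Indeed, on such a W the commutator satisfies
        [x, [y, z]] = <x, z> y - <x, y> z,
    and the two cases, W containing an anisotropic vector or W totally isotropic,
    follow from two facts on imaginary octonions: independent vectors in one
    eigenspace of [q, -], for a nonzero eigenvalue, do not commute
    ([eigen_cross]); and, as a consequence, three independent vectors never
    commute pairwise ([null_dim]).

    Given W = <x, y, [x, y]>, move x to e_1 and y to e_2 along segments x_t, y_t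
    and put W_t = <x_t, y_t, [x_t, y_t]>.  If the Gram determinant of x_t, y_t and
    the norm of x_t are nonzero, then W_t lies in the orbit of W0: an orthonormal
    basis a, b of <x_t, y_t> spans with 1 and ab a copy of the quaternions, and by
    Cayley-Dickson doubling this copy extends to an automorphism of the octonions
    taking e_1, e_2, e_3 to a, b, ab ([isG2_double], [orbit_generated]).  The
    condition on t is polynomial and holds at t = 1.  A form F vanishing on the
    orbit, evaluated at the Plücker coordinates of x_t, y_t, [x_t, y_t], is a
    polynomial in t which vanishes wherever the condition holds; so it vanishes
    identically, in particular at t = 0, where W_t is W ([generated_closure]). *)

Set Implicit Arguments.
Unset Strict Implicit.
Unset Printing Implicit Defensive.

(** * Two by two matrices in the basis 1, i, j, k *)
Section Quaternions.
Variable R : realType.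
Local Notation C := (R[i])%C.
Local Notation im := ('i%C : C).
Local Notation D := ('M[C]_2).
Local Notation O := (octonion R).
Implicit Types (p q : D) (x y z : O).

Definition q0 p : C := 2^-1 * (p 0 0 + p 1 1).
Definition q1 p : C := - (2^-1 * im) * (p 0 0 - p 1 1).
Definition q2 p : C := 2^-1 * (p 0 1 - p 1 0).
Definition q3 p : C := - (2^-1 * im) * (p 0 1 + p 1 0).

Lemma two_neq0 : 2 != 0 :> C. Proof. by rewrite Num.Theory.pnatr_eq0. Qed.
Lemma im_sqr : im * im = -1. Proof. by rewrite -expr2 sqr_i. Qed.
Lemma half_two : 2^-1 * 2 = 1 :> C. Proof. exact: mulVf two_neq0. Qed.
(** Ring normalisation treats 2^-1 as an atom; multiplying one side by 2^-1 * 2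
    makes both sides agree without using the relation between 2 and 2^-1. *)
Lemma half_twoK (a : C) : a = 2^-1 * 2 * a. Proof. by rewrite half_two mul1r. Qed.

Lemma mulmx2E p q i j : (p *m q) i j = p i 0 * q 0 j + p i 1 * q 1 j.
Proof. by rewrite mxE big_ord_recl big_ord1; congr (_ + p i _ * q _ j); apply: val_inj. Qed.
Lemma tr2E p : \tr p = p 0 0 + p 1 1.
Proof. by rewrite /mxtrace big_ord_recl big_ord1; congr (_ + p _ _); apply: val_inj. Qed.
Lemma qconjE p i j : qconj p i j = (p 0 0 + p 1 1) *+ (i == j) - p i j.
Proof. by rewrite /qconj tr2E !mxE. Qed.
Lemma det2E p : \det p = p 0 0 * p 1 1 - p 0 1 * p 1 0.
Proof.
rewrite (expand_det_row _ ord0) big_ord_recl big_ord1 /cofactor !det_mx11 !mxE /=.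
rewrite !expr0 !expr1 !mulN1r mulrN mul1r.
by congr (p _ _ * p _ _ - p _ _ * p _ _); apply: val_inj.
Qed.

Lemma quatE p : [/\ p 0 0 = q0 p + im * q1 p, p 1 1 = q0 p - im * q1 p,
  p 0 1 = q2 p + im * q3 p & p 1 0 = - q2 p + im * q3 p].
Proof.
rewrite /q0 /q1 /q2 /q3; have hz := im_sqr.
by split; rewrite [LHS]half_twoK; move: hz; set h := 2^-1; set z := im => hz; ring: hz.
Qed.

Lemma quatM p q :
  [/\ q0 (p *m q) = q0 p * q0 q - q1 p * q1 q - q2 p * q2 q - q3 p * q3 q,
      q1 (p *m q) = q0 p * q1 q + q1 p * q0 q + q2 p * q3 q - q3 p * q2 q,
      q2 (p *m q) = q0 p * q2 q - q1 p * q3 q + q2 p * q0 q + q3 p * q1 q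
    & q3 (p *m q) = q0 p * q3 q + q1 p * q2 q - q2 p * q1 q + q3 p * q0 q].
Proof.
have hz := im_sqr.
split; [rewrite [LHS]/q0|rewrite [LHS]/q1|rewrite [LHS]/q2|rewrite [LHS]/q3];
  rewrite !mulmx2E; have [-> -> -> ->] := quatE p; have [-> -> -> ->] := quatE q;
  rewrite [RHS]half_twoK; move: hz; set h := 2^-1; set z := im => hz; ring: hz.
Qed.

Lemma quat_conj p : [/\ q0 (qconj p) = q0 p, q1 (qconj p) = - q1 p,
  q2 (qconj p) = - q2 p & q3 (qconj p) = - q3 p].
Proof. by split; rewrite /q0 /q1 /q2 /q3 !qconjE /= ?mulr1n ?mulr0n; ring. Qed.

Lemma quatD p q : [/\ q0 (p + q) = q0 p + q0 q, q1 (p + q) = q1 p + q1 q,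
  q2 (p + q) = q2 p + q2 q & q3 (p + q) = q3 p + q3 q].
Proof. by split; rewrite /q0 /q1 /q2 /q3 !mxE; ring. Qed.

Lemma quatZ (a : C) p : [/\ q0 (a *: p) = a * q0 p, q1 (a *: p) = a * q1 p,
  q2 (a *: p) = a * q2 p & q3 (a *: p) = a * q3 p].
Proof. by split; rewrite /q0 /q1 /q2 /q3 !mxE; ring. Qed.

Lemma quatN p : [/\ q0 (- p) = - q0 p, q1 (- p) = - q1 p,
  q2 (- p) = - q2 p & q3 (- p) = - q3 p].
Proof. by split; rewrite /q0 /q1 /q2 /q3 !mxE; ring. Qed.

Lemma quat0 : [/\ q0 0 = 0, q1 0 = 0, q2 0 = 0 & q3 0 = 0].
Proof. by split; rewrite /q0 /q1 /q2 /q3 !mxE; ring. Qed.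

Lemma quat_det p : \det p = q0 p * q0 p + q1 p * q1 p + q2 p * q2 p + q3 p * q3 p.
Proof.
rewrite det2E; have [-> -> -> ->] := quatE p.
have := im_sqr; set z := im => hz; ring: hz.
Qed.

Lemma quat1 : [/\ q0 1%:M = 1, q1 1%:M = 0, q2 1%:M = 0 & q3 1%:M = 0].
Proof.
rewrite /q0 /q1 /q2 /q3 !mxE /= ?mulr1n ?mulr0n subrr addr0 subr0 !mulr0.
by split=> //; rewrite -[1 + 1]/(2 : C) half_two.
Qed.

Lemma quat_i : [/\ q0 (qi R) = 0, q1 (qi R) = 1, q2 (qi R) = 0 & q3 (qi R) = 0].
Proof.
have hz := im_sqr; rewrite /q0 /q1 /q2 /q3 !mxE /=.
split; [ring| rewrite -[RHS]half_two |ring|ring].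
by move: hz; set h := 2^-1; set z := im => hz; ring: hz.
Qed.

Lemma quat_j : [/\ q0 (qj R) = 0, q1 (qj R) = 0, q2 (qj R) = 1 & q3 (qj R) = 0].
Proof.
rewrite /q0 /q1 /q2 /q3 !mxE /=.
by split; [ring | ring | rewrite -[RHS]half_two; ring | ring].
Qed.

Lemma quat_k : [/\ q0 (qk R) = 0, q1 (qk R) = 0, q2 (qk R) = 0 & q3 (qk R) = 1].
Proof.
have hz := im_sqr; rewrite /q0 /q1 /q2 /q3 !mxE /=.
split; [ring|ring|ring|rewrite -[RHS]half_two].
by move: hz; set h := 2^-1; set z := im => hz; ring: hz.
Qed.

Lemma quat_inj p q : q0 p = q0 q -> q1 p = q1 q -> q2 p = q2 q -> q3 p = q3 q ->
  p = q.
Proof.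
move=> h0 h1 h2 h3; have [a b c d] := quatE p; have [a' b' c' d'] := quatE q.
have ord2 (i : 'I_2) : i = 0 \/ i = 1.
  by case: i => -[|[|//]] ?; [left | right]; apply: val_inj.
by apply/matrixP => i j; case: (ord2 i) (ord2 j) => -> [] ->;
  rewrite ?(a, b, c, d) ?(a', b', c', d') ?h0 ?h1 ?h2 ?h3.
Qed.
End Quaternions.

(** * Octonions in coordinates over a commutative ring *)
Section Coordinates.
Variable A : comNzRingType.

(** Octonions as coordinate vectors in the basis 1, e_1, ..., e_7.  Over an
    abstract commutative ring the identities below are polynomial identities with
    integer coefficients, in which the imaginary unit does not occur. *)
Inductive oct8 := Oct8 of A & A & A & A & A & A & A & A.
Implicit Types x y z : oct8.

Definition add8 x y :=
  let: Oct8 x0 x1 x2 x3 x4 x5 x6 x7 := x in let: Oct8 y0 y1 y2 y3 y4 y5 y6 y7 := y in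
  Oct8 (x0 + y0) (x1 + y1) (x2 + y2) (x3 + y3) (x4 + y4) (x5 + y5) (x6 + y6) (x7 + y7).
Definition opp8 x := let: Oct8 x0 x1 x2 x3 x4 x5 x6 x7 := x in
  Oct8 (- x0) (- x1) (- x2) (- x3) (- x4) (- x5) (- x6) (- x7).
Definition scale8 a x := let: Oct8 x0 x1 x2 x3 x4 x5 x6 x7 := x in
  Oct8 (a * x0) (a * x1) (a * x2) (a * x3) (a * x4) (a * x5) (a * x6) (a * x7).
Definition one8 := Oct8 1 0 0 0 0 0 0 0.
Definition mul8 x y :=
  let: Oct8 x0 x1 x2 x3 x4 x5 x6 x7 := x in let: Oct8 y0 y1 y2 y3 y4 y5 y6 y7 := y in
  Oct8
    (x0 * y0 - x1 * y1 - x2 * y2 - x3 * y3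
      + x4 * y4 + x5 * y5 + x6 * y6 + x7 * y7)
    (x0 * y1 + x1 * y0 + x2 * y3 - x3 * y2
      + x5 * y4 - x4 * y5 - x7 * y6 + x6 * y7)
    (x0 * y2 - x1 * y3 + x2 * y0 + x3 * y1
      + x6 * y4 + x7 * y5 - x4 * y6 - x5 * y7)
    (x0 * y3 + x1 * y2 - x2 * y1 + x3 * y0
      + x7 * y4 - x6 * y5 + x5 * y6 - x4 * y7)
    (x0 * y4 - x1 * y5 - x2 * y6 - x3 * y7
      + x4 * y0 + x5 * y1 + x6 * y2 + x7 * y3)
    (x1 * y4 + x0 * y5 + x3 * y6 - x2 * y7
      - x4 * y1 + x5 * y0 - x6 * y3 + x7 * y2)
    (x2 * y4 - x3 * y5 + x0 * y6 + x1 * y7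
      - x4 * y2 + x5 * y3 + x6 * y0 - x7 * y1)
    (x3 * y4 + x2 * y5 - x1 * y6 + x0 * y7
      - x4 * y3 - x5 * y2 + x6 * y1 + x7 * y0).
Definition dot8 x y :=
  let: Oct8 x0 x1 x2 x3 x4 x5 x6 x7 := x in let: Oct8 y0 y1 y2 y3 y4 y5 y6 y7 := y in
  x0 * y0 + x1 * y1 + x2 * y2 + x3 * y3
  - (x4 * y4 + x5 * y5 + x6 * y6 + x7 * y7).
Definition re8 x := let: Oct8 x0 _ _ _ _ _ _ _ := x in x0.
Definition sub8 x y := add8 x (opp8 y).
Definition conj8 x := sub8 (scale8 (2 * re8 x) one8) x.
Definition cross8 x y := sub8 (mul8 x y) (mul8 y x).

End Coordinates.

Ltac ring8 := lazy beta iota zeta delta [cross8 conj8 sub8 add8 opp8 scale8 one8 mul8 dot8 re8];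
  (congr Oct8 || idtac); ring.

Section CoordIdentities.
Variable A : comNzRingType.
Implicit Types x y z : oct8 A.

(** Polarisation of the double cross product formula
    x * (x * z) = <x, z> x - <x, x> z; the constants come from the commutator
    being twice the cross product. *)
Lemma cross8_cross x y z : re8 x = 0 -> re8 y = 0 -> re8 z = 0 ->
  add8 (cross8 x (cross8 y z)) (cross8 y (cross8 x z)) =
  sub8 (add8 (scale8 (4 * dot8 x z) y) (scale8 (4 * dot8 y z) x)) (scale8 (8 * dot8 x y) z).
Proof. by destruct x, y, z => /= -> -> ->; ring8. Qed.

(** The associator measures by how much the cross product fails to satisfy the
    double product formula x * (y * z) = <x, z> y - <x, y> z of 3-space. *)
Lemma assoc8_cross x y z : re8 x = 0 -> re8 y = 0 -> re8 z = 0 ->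
  scale8 2 (sub8 (mul8 (mul8 x y) z) (mul8 x (mul8 y z))) =
  sub8 (scale8 (4 * dot8 x z) y) (add8 (scale8 (4 * dot8 x y) z) (cross8 x (cross8 y z))).
Proof. by destruct x, y, z => /= -> -> ->; ring8. Qed.

Lemma cross8_skew x y z :
  dot8 (cross8 x y) z = - dot8 y (cross8 x z).
Proof. by destruct x, y, z; ring8. Qed.

(** Linearisation of x (x^- z) = N(x) z, with x^- the conjugate of x; this and
    its mirror image are the source of all the doubling identities. *)
Lemma conj8_mull x y z :
  add8 (mul8 x (mul8 (conj8 y) z)) (mul8 y (mul8 (conj8 x) z)) = scale8 (2 * dot8 x y) z.
Proof. by destruct x, y, z; ring8. Qed.

Lemma conj8_mulr x y z :
  add8 (mul8 (mul8 z (conj8 x)) y) (mul8 (mul8 z (conj8 y)) x) = scale8 (2 * dot8 x y) z.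
Proof. by destruct x, y, z; ring8. Qed.

Lemma dot8_mull x y z :
  dot8 (mul8 x y) z = dot8 y (mul8 (conj8 x) z).
Proof. by destruct x, y, z; ring8. Qed.

Lemma dot8_mulr x y z :
  dot8 (mul8 x y) z = dot8 x (mul8 z (conj8 y)).
Proof. by destruct x, y, z; ring8. Qed.

Lemma alt8l x y :
  mul8 x (mul8 x y) = mul8 (mul8 x x) y.
Proof. by destruct x, y; ring8. Qed.

Lemma alt8r x y :
  mul8 (mul8 x y) y = mul8 x (mul8 y y).
Proof. by destruct x, y; ring8. Qed.

Lemma conj8M x y :
  conj8 (mul8 x y) = mul8 (conj8 y) (conj8 x).
Proof. by destruct x, y; ring8. Qed.

End CoordIdentities.

(** * The octonion algebra and its coordinates *)
Section Octonions.
Variable R : realType.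
Local Notation C := (R[i])%C.
Local Notation O := (octonion R).
Local Notation im := ('i%C : C).
Implicit Types (x y z : O).

Definition oc x : oct8 C :=
  Oct8 (q0 x.1) (q1 x.1) (q2 x.1) (q3 x.1) (q0 x.2) (q1 x.2) (q2 x.2) (q3 x.2).

Lemma oc_inj : injective oc.
Proof. by move=> [a b] [c d] [*]; congr pair; apply: quat_inj. Qed.

Lemma ocM x y : oc (omul x y) = mul8 (oc x) (oc y).
Proof.
rewrite /oc /omul /=.
have [-> -> -> ->] := quatD (x.1 *m y.1) (qconj y.2 *m x.2).
have [-> -> -> ->] := quatD (y.2 *m x.1) (x.2 *m qconj y.1).
have [-> -> -> ->] := quatM x.1 y.1; have [-> -> -> ->] := quatM (qconj y.2) x.2.
have [-> -> -> ->] := quatM y.2 x.1; have [-> -> -> ->] := quatM x.2 (qconj y.1).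
have [-> -> -> ->] := quat_conj y.1; have [-> -> -> ->] := quat_conj y.2.
by congr Oct8; ring.
Qed.

Lemma ocD x y : oc (x + y) = add8 (oc x) (oc y).
Proof.
rewrite /oc -[(x + y).1]/(x.1 + y.1) -[(x + y).2]/(x.2 + y.2).
by have [-> -> -> ->] := quatD x.1 y.1; have [-> -> -> ->] := quatD x.2 y.2.
Qed.

Lemma ocN x : oc (- x) = opp8 (oc x).
Proof.
rewrite /oc -[(- x).1]/(- x.1) -[(- x).2]/(- x.2).
by have [-> -> -> ->] := quatN x.1; have [-> -> -> ->] := quatN x.2.
Qed.

Lemma ocZ (a : C) x : oc (a *: x) = scale8 a (oc x).
Proof.
rewrite /oc -[(a *: x).1]/(a *: x.1) -[(a *: x).2]/(a *: x.2).
by have [-> -> -> ->] := quatZ a x.1; have [-> -> -> ->] := quatZ a x.2.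
Qed.

Lemma oc1 : oc (oone R) = one8 C.
Proof.
by rewrite /oc /one8 /=; have [-> -> -> ->] := quat1 R; have [-> -> -> ->] := quat0 R.
Qed.

Lemma oc0 : oc 0 = Oct8 0 0 0 0 0 0 0 0.
Proof.
rewrite /oc -[(0 : O).1]/(0 : 'M[C]_2) -[(0 : O).2]/(0 : 'M[C]_2).
by have [-> -> -> ->] := quat0 R.
Qed.

Lemma oc_ebasis :
  ((oc (qi R, 0) = Oct8 0 1 0 0 0 0 0 0) *
   (oc (qj R, 0) = Oct8 0 0 1 0 0 0 0 0) *
   (oc (qk R, 0) = Oct8 0 0 0 1 0 0 0 0) *
   (oc (0, 1%:M) = Oct8 0 0 0 0 1 0 0 0) *
   (oc (0, qi R) = Oct8 0 0 0 0 0 1 0 0) *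
   (oc (0, qj R) = Oct8 0 0 0 0 0 0 1 0) *
   (oc (0, qk R) = Oct8 0 0 0 0 0 0 0 1))%type.
Proof.
rewrite /oc /=; have [-> -> -> ->] := quat_i R; have [-> -> -> ->] := quat_j R.
have [-> -> -> ->] := quat_k R; have [-> -> -> ->] := quat1 R.
by have [-> -> -> ->] := quat0 R.
Qed.

Lemma onormE x : onorm x = dot8 (oc x) (oc x).
Proof. by rewrite /onorm !quat_det. Qed.

Lemma obilinE x y : obilin x y = 2 * dot8 (oc x) (oc y).
Proof.
rewrite /obilin !onormE ocD; move: (oc x) (oc y) => X Y.
by destruct X, Y; ring8.
Qed.

Lemma imOE x : (x \in @imO R) = (re8 (oc x) == 0).
Proof.
rewrite inE obilinE oc1; destruct (oc x) => /=.
by rewrite !mul0r mul1r !addr0 subr0 mulf_eq0 (negPf (two_neq0 R)).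
Qed.

Lemma im_re8 x : x \in @imO R -> re8 (oc x) = 0.
Proof. by rewrite imOE => /eqP. Qed.

Definition oconj : O -> O := locked (fun x => (2 * re8 (oc x)) *: oone R - x).
Lemma oconjE x : oconj x = (2 * re8 (oc x)) *: oone R - x.
Proof. by rewrite /oconj -lock. Qed.
(** The commutator of imaginary octonions is twice their cross product.  With the
    form [dot] below, the double product formulas have integer coefficients.
    Both are locked, like the conjugation, because unification would otherwise
    unfold them to matrices. *)
Definition cross : O -> O -> O := locked (fun x y => omul x y - omul y x).
Lemma crossE x y : cross x y = omul x y - omul y x.
Proof. by rewrite /cross -lock. Qed.
Definition dot : O -> O -> C := locked (fun x y => 2 * obilin x y).

Lemma dotE x y : dot x y = 4 * dot8 (oc x) (oc y).
Proof. by rewrite /dot -lock obilinE; ring. Qed.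

Lemma oc_conj x : oc (oconj x) = conj8 (oc x).
Proof. by rewrite oconjE ocD ocZ ocN oc1. Qed.
Lemma oc_cross x y : oc (cross x y) = cross8 (oc x) (oc y).
Proof. by rewrite crossE ocD ocN !ocM. Qed.
End Octonions.

#[export] Hint Rewrite oc_conj oc_cross ocM ocD ocN ocZ oc1 oc0 : octE.
Ltac coords := apply: oc_inj; autorewrite with octE.

Section Identities.
Variable R : realType.
Local Notation C := (R[i])%C.
Local Notation O := (octonion R).
Implicit Types (x y z : O).

Definition ofc (t : oct8 C) : O := let: Oct8 x0 x1 x2 x3 x4 x5 x6 x7 := t in
  x0 *: oone R + x1 *: (qi R, 0) + x2 *: (qj R, 0) + x3 *: (qk R, 0)
  + x4 *: (0, 1%:M) + x5 *: (0, qi R) + x6 *: (0, qj R) + x7 *: (0, qk R).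

Lemma ofcK : cancel ofc (@oc R).
Proof.
case=> x0 x1 x2 x3 x4 x5 x6 x7; rewrite /ofc; autorewrite with octE.
by rewrite !oc_ebasis; ring8.
Qed.

Lemma cross_cross x y z : x \in @imO R -> y \in @imO R -> z \in @imO R ->
  cross x (cross y z) + cross y (cross x z) = dot x z *: y + dot y z *: x - (2 * dot x y) *: z.
Proof.
move=> /im_re8 hx /im_re8 hy /im_re8 hz; coords; rewrite !dotE.
by rewrite cross8_cross // /sub8; congr add8; congr opp8; congr scale8; ring.
Qed.

Lemma assoc_cross x y z : x \in @imO R -> y \in @imO R -> z \in @imO R ->
  2 *: (omul (omul x y) z - omul x (omul y z)) =
  dot x z *: y - (dot x y *: z + cross x (cross y z)).
Proof.
move=> /im_re8 hx /im_re8 hy /im_re8 hz; coords; rewrite !dotE.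
exact: (assoc8_cross hx hy hz).
Qed.

Lemma cross_skew x y z : dot (cross x y) z = - dot y (cross x z).
Proof. by rewrite !dotE oc_cross cross8_skew -oc_cross mulrN. Qed.

Lemma oconj_mull x y z :
  omul x (omul (oconj y) z) + omul y (omul (oconj x) z) = obilin x y *: z.
Proof. by coords; rewrite obilinE; exact: conj8_mull. Qed.

Lemma oconj_mulr x y z :
  omul (omul z (oconj x)) y + omul (omul z (oconj y)) x = obilin x y *: z.
Proof. by coords; rewrite obilinE; exact: conj8_mulr. Qed.

Lemma obilin_mull x y z : obilin (omul x y) z = obilin y (omul (oconj x) z).
Proof. by rewrite !obilinE; autorewrite with octE; rewrite dot8_mull. Qed.

Lemma obilin_mulr x y z : obilin (omul x y) z = obilin x (omul z (oconj y)).
Proof. by rewrite !obilinE; autorewrite with octE; rewrite dot8_mulr. Qed.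

Lemma altl x y : omul x (omul x y) = omul (omul x x) y.
Proof. by coords; rewrite alt8l. Qed.

Lemma altr x y : omul (omul x y) y = omul x (omul y y).
Proof. by coords; rewrite alt8r. Qed.

Lemma oconjM x y : oconj (omul x y) = omul (oconj y) (oconj x).
Proof. by coords; rewrite conj8M. Qed.

Lemma cross_im x y : cross x y \in @imO R.
Proof.
rewrite imOE oc_cross; destruct (oc x), (oc y) => /=.
by apply/eqP; ring.
Qed.

End Identities.

(** * Linear independence of two and three vectors *)
Section LinAlg.
Variables (F : fieldType) (V : vectType F).
Implicit Types (x y z w : V) (W : {vspace V}).

Definition li2 x y := forall a b : F, a *: x + b *: y = 0 -> a = 0 /\ b = 0.
Definition li3 x y z := forall a b c : F, a *: x + b *: y + c *: z = 0 ->
  [/\ a = 0, b = 0 & c = 0].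

Lemma span2P x y w : reflect (exists a b, w = a *: x + b *: y) (w \in <<[:: x; y]>>%VS).
Proof.
rewrite span_cons span_seq1; apply: (iffP memv_addP).
  by case=> _ /vlineP[a ->] [_ /vlineP[b ->] ->]; exists a, b.
by case=> a [b ->]; exists (a *: x); [|exists (b *: y)]; rewrite ?memvZ ?memv_line.
Qed.

Lemma span3P x y z w :
  reflect (exists a b c, w = a *: x + b *: y + c *: z) (w \in <<[:: x; y; z]>>%VS).
Proof.
rewrite span_cons; apply: (iffP memv_addP).
  by case=> _ /vlineP[a ->] [_ /span2P[b [c ->]] ->]; exists a, b, c; rewrite addrA.
case=> a [b [c ->]]; exists (a *: x); first by rewrite memvZ ?memv_line.
by exists (b *: y + c *: z); [apply/span2P; exists b, c | rewrite addrA].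
Qed.

Lemma li2_free x y : reflect (li2 x y) (free [:: x; y]).
Proof.
rewrite free_cons seq1_free span_seq1; apply: (iffP andP).
  move=> [nx ny] a b; have [-> | na] := eqVneq a 0.
    rewrite scale0r add0r => /eqP; rewrite scaler_eq0 (negPf ny) orbF => /eqP->.
    by [].
  move=> /eqP; rewrite addr_eq0 => /eqP e; case/negP: nx.
  by rewrite -[x](scalerK na) e scalerN -scaleNr scalerA memvZ ?memv_line.
move=> h; split; last first.
  apply/eqP => y0; have [|_ /eqP] := h 0 1; first by rewrite y0 scaler0 scale0r addr0.
  by rewrite oner_eq0.
apply/vlineP => -[k e]; have [|/eqP] := h 1 (- k).
  by rewrite scale1r scaleNr e subrr.
by rewrite oner_eq0.
Qed.

Lemma li3_free x y z : reflect (li3 x y z) (free [:: x; y; z]).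
Proof.
rewrite free_cons; apply: (iffP andP).
  move=> [nx /li2_free nyz] a b c; have [-> | na] := eqVneq a 0.
    by rewrite scale0r add0r => /nyz[-> ->].
  move=> /eqP; rewrite -addrA addr_eq0 => /eqP e; case/negP: nx.
  rewrite -[x](scalerK na) e memvZ // memvN; apply/span2P; by exists b, c.
move=> h; split; last first.
  by apply/li2_free => b c e; have [|_ -> ->] := h 0 b c; rewrite ?scale0r ?add0r.
apply/span2P => -[k [l e]]; have [|/eqP] := h 1 (- k) (- l).
  by rewrite scale1r !scaleNr e addrAC addrK subrr.
by rewrite oner_eq0.
Qed.

Lemma extend_free (X : seq V) W : free X -> {subset X <= W} ->
  exists2 Y : seq V, {subset Y <= W} & free (X ++ Y) /\ <<X ++ Y>>%VS = W.
Proof.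
move=> fX /span_subvP sX; exists (vbasis (W :\: <<X>>)).
  by move=> y /vbasis_mem; apply/subvP/diffvSl.
have /andP[/eqP sB fB] : basis_of (<<X>> + (W :\: <<X>>))%VS (X ++ vbasis (W :\: <<X>>)).
  apply: cat_basis; [|by rewrite /basis_of eqxx fX|exact: vbasisP].
  by apply/directv_addP; rewrite capvC capv_diff.
by split=> //; rewrite sB addvC addv_diff; apply/addv_idPl.
Qed.

Lemma extend0 W : \dim W = 3%N ->
  exists x y z, [/\ x \in W, y \in W, z \in W & li3 x y z].
Proof.
move=> dW; have [||Y sY [fY eY]] := @extend_free [::] W; rewrite ?nil_free //.
have : size Y = 3%N by rewrite -dW -eY (eqnP fY).
case: Y => [|x [|y [|z []]]] //= in sY fY eY * => _; exists x, y, z.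
by split; rewrite ?sY ?inE ?eqxx ?orbT //; apply/li3_free.
Qed.

Lemma extend1 x W : \dim W = 3%N -> x \in W -> x != 0 ->
  exists y z, [/\ y \in W, z \in W & li3 x y z].
Proof.
move=> dW xW x0; have [||Y sY [fY eY]] := @extend_free [:: x] W; rewrite ?seq1_free //.
  by move=> y; rewrite inE => /eqP->.
have : size ([:: x] ++ Y) = 3%N by rewrite -dW -eY (eqnP fY).
case: Y => [|y [|z []]] //= in sY fY eY * => _.
by exists y, z; split; rewrite ?sY ?inE ?eqxx ?orbT //; apply/li3_free.
Qed.

Lemma extend2 x y W : \dim W = 3%N -> x \in W -> y \in W -> li2 x y ->
  exists2 z, z \in W & li3 x y z.
Proof.
move=> dW xW yW /li2_free f2; have [//||Y sY [fY eY]] := @extend_free [:: x; y] W.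
  by move=> z; rewrite !inE => /orP[] /eqP->.
have : size ([:: x; y] ++ Y) = 3%N by rewrite -dW -eY (eqnP fY).
case: Y => [|z []] //= in sY fY eY * => _.
by exists z; rewrite ?sY ?inE ?eqxx //; apply/li3_free.
Qed.

Lemma li3_span x y z W : \dim W = 3%N -> x \in W -> y \in W -> z \in W ->
  li3 x y z -> <<[:: x; y; z]>>%VS = W.
Proof.
move=> dW xW yW zW /li3_free f3; apply/eqP; rewrite eqEdim dW (eqnP f3) andbT.
by apply/span_subvP => t; rewrite !inE => /or3P[] /eqP->.
Qed.

Lemma li3_12 x y z : li3 x y z -> li2 x y.
Proof. by move=> h a b e; have [|-> -> _] := h a b 0; rewrite ?scale0r ?addr0. Qed.
Lemma li3_23 x y z : li3 x y z -> li2 y z.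
Proof. by move=> h a b e; have [|_ -> ->] := h 0 a b; rewrite ?scale0r ?add0r. Qed.
Lemma li3_rot x y z : li3 x y z -> li3 y z x.
Proof. by move=> h a b c e; have [|-> -> ->] := h c a b; rewrite // -addrA addrC. Qed.
Lemma li2_sym x y : li2 x y -> li2 y x.
Proof. by move=> h a b e; have [|-> ->] := h b a; rewrite // addrC. Qed.
Lemma li2_neq0 x y : li2 x y -> x != 0.
Proof.
move=> h; apply/eqP => x0; have [|/eqP] := h 1 0; first by rewrite x0 scaler0 scale0r addr0.
by rewrite oner_eq0.
Qed.
Lemma li2_nspan x y : x != 0 -> (forall a, y <> a *: x) -> li2 x y.
Proof.
move=> x0 h a b; have [-> | nb] := eqVneq b 0.
  by rewrite scale0r addr0 => /eqP; rewrite scaler_eq0 (negPf x0) orbF => /eqP->.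
move/eqP; rewrite addrC addr_eq0 => /eqP e; case: (h (b^-1 * - a)).
by rewrite -[y](scalerK nb) e scalerN scalerA mulrN scaleNr.
Qed.
Lemma li3_nspan x y z : li2 x y -> z \notin <<[:: x; y]>>%VS -> li3 x y z.
Proof. by move=> h nz; apply/li3_rot/li3_free; rewrite free_cons nz; apply/li2_free. Qed.
(** Used to make two vectors of a basis orthogonal to the remaining one. *)
Lemma li3_shear x y z k l : li3 x y z -> li3 x (y - k *: x) (z - l *: x).
Proof.
move=> h a b c; rewrite !scalerBr !scalerA -!scaleNr.
rewrite (AC (1*2*2) ((1*3*5)*2*4)) /= -!scalerDl => /h[+ b0 c0].
by rewrite b0 c0 !mul0r oppr0 !addr0.
Qed.

End LinAlg.

(** * Null products of imaginary octonions *)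
Section Cross.
Variable R : realType.
Local Notation C := (R[i])%C.
Local Notation O := (octonion R).
Local Notation I := (@imO R).
Implicit Types (x y z p q u v w : O) (a b c k : C) (W : {vspace O}).

Lemma imOD x y : x \in I -> y \in I -> x + y \in I.
Proof.
rewrite !imOE; autorewrite with octE; destruct (oc x), (oc y) => /=.
by move=> /eqP-> /eqP->; rewrite addr0.
Qed.
Lemma imOZ k x : x \in I -> k *: x \in I.
Proof.
rewrite !imOE; autorewrite with octE; destruct (oc x) => /=.
by move=> /eqP->; rewrite mulr0.
Qed.
Lemma imON x : x \in I -> - x \in I.
Proof. by rewrite -scaleN1r; apply: imOZ. Qed.
Lemma imOB x y : x \in I -> y \in I -> x - y \in I.
Proof. by move=> hx hy; rewrite imOD ?imON. Qed.
Hint Resolve cross_im imOD imOZ imON imOB : core.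

Lemma crossDr x y z : cross x (y + z) = cross x y + cross x z.
Proof. by coords; destruct (oc x), (oc y), (oc z); ring8. Qed.
Lemma crossZr k x y : cross x (k *: y) = k *: cross x y.
Proof. by coords; destruct (oc x), (oc y); ring8. Qed.
Lemma cross_anti x y : cross y x = - cross x y.
Proof. by rewrite !crossE opprB. Qed.
Lemma crossDl x y z : cross (y + z) x = cross y x + cross z x.
Proof. by rewrite cross_anti crossDr opprD -!(cross_anti x). Qed.
Lemma crossZl k x y : cross (k *: y) x = k *: cross y x.
Proof. by rewrite cross_anti crossZr -scalerN -cross_anti. Qed.
Lemma crossxx x : cross x x = 0. Proof. by rewrite crossE subrr. Qed.
Lemma crossNr x y : cross x (- y) = - cross x y. Proof. by rewrite -scaleN1r crossZr scaleN1r. Qed.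
Lemma cross0r x : cross x 0 = 0. Proof. by have := crossZr 0 x x; rewrite !scale0r. Qed.
Lemma cross0l x : cross 0 x = 0. Proof. by rewrite cross_anti cross0r oppr0. Qed.
Lemma dot_sym x y : dot x y = dot y x.
Proof. by rewrite !dotE; destruct (oc x), (oc y); ring8. Qed.
Lemma dotDr x y z : dot x (y + z) = dot x y + dot x z.
Proof.
by rewrite !dotE ocD; destruct (oc x), (oc y), (oc z); ring8.
Qed.
Lemma dotZr k x y : dot x (k *: y) = k * dot x y.
Proof. by rewrite !dotE ocZ; destruct (oc x), (oc y); ring8. Qed.
Lemma dotDl x y z : dot (y + z) x = dot y x + dot z x.
Proof. by rewrite !(dot_sym _ x) dotDr. Qed.
Lemma dotZl k x y : dot (k *: y) x = k * dot y x.
Proof. by rewrite !(dot_sym _ x) dotZr. Qed.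
Lemma dotNr x y : dot x (- y) = - dot x y. Proof. by rewrite -scaleN1r dotZr mulN1r. Qed.
Lemma dotNl x y : dot (- y) x = - dot y x. Proof. by rewrite -scaleN1r dotZl mulN1r. Qed.
Lemma dot0r x : dot x 0 = 0. Proof. by have := dotZr 0 x x; rewrite scale0r mul0r. Qed.

Lemma dot_cross_l x y : dot x (cross x y) = 0.
Proof. by apply/eqP; rewrite -oppr_eq0 -cross_skew crossxx dot_sym dot0r. Qed.

Lemma cross_sq x z : x \in I -> z \in I -> cross x (cross x z) = dot x z *: x - dot x x *: z.
Proof.
move=> hx hz; apply: (scalerI (two_neq0 R)); rewrite [LHS]scaler_nat mulr2n cross_cross //.
by rewrite scalerBr !scalerA !mulr_natl !mulr2n -scalerDl.
Qed.

(** Nondegeneracy of [dot] on I; this and the next two lemmas give the vector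
    dual to the first member of an independent family. *)
Lemma dual1 x : x \in I -> x != 0 -> exists2 p, p \in I & dot p x = 1.
Proof.
move=> ix x0; suff [p ip px] : exists2 p, p \in I & dot p x != 0.
  by exists ((dot p x)^-1 *: p); auto; rewrite dotZl mulVf.
have [//|none] := pselect (exists2 p, p \in I & dot p x != 0).
have orth t : re8 t = 0 -> dot8 t (oc x) = 0.
  move=> t0; have four0 : 4 != 0 :> C by rewrite Num.Theory.pnatr_eq0.
  apply: (mulfI four0); rewrite mulr0 -[t]ofcK -dotE; apply/eqP/negPn/negP => px.
  by case: none; exists (ofc t); rewrite // imOE ofcK t0.
have nz : oc x <> oc 0 by move/oc_inj; apply/eqP.
move: ix nz orth; rewrite imOE oc0.
case: (oc x) => [? x1 x2 x3 x4 x5 x6 x7] /= /eqP-> nz orth; case: nz.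
have e1 := orth (Oct8 0 1 0 0 0 0 0 0) erefl.
have e2 := orth (Oct8 0 0 1 0 0 0 0 0) erefl.
have e3 := orth (Oct8 0 0 0 1 0 0 0 0) erefl.
have e4 := orth (Oct8 0 0 0 0 (-1) 0 0 0) erefl.
have e5 := orth (Oct8 0 0 0 0 0 (-1) 0 0) erefl.
have e6 := orth (Oct8 0 0 0 0 0 0 (-1) 0) erefl.
have e7 := orth (Oct8 0 0 0 0 0 0 0 (-1)) erefl.
move: e1 e2 e3 e4 e5 e6 e7; rewrite /dot8 !mul0r !mul1r !mulN1r ?add0r ?addr0 ?subr0 ?sub0r ?opprK.
by move=> -> -> -> -> -> -> ->.
Qed.

Lemma dual2 x y : x \in I -> y \in I -> li2 x y ->
  exists p, [/\ p \in I, dot p x = 1 & dot p y = 0].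
Proof.
move=> hx hy h; have [p1 ip1 p1y] := dual1 hy (li2_neq0 (li2_sym h)).
have [||q iq] := @dual1 (x - dot p1 x *: y); first by auto.
  apply/eqP => e; have [|/eqP] := h 1 (- dot p1 x); first by rewrite scale1r scaleNr.
  by rewrite oner_eq0.
rewrite dotDr dotNr dotZr => e.
exists (q - dot q y *: p1); split; auto; rewrite dotDl dotNl dotZl.
  by rewrite mulrC e.
by rewrite p1y mulr1 subrr.
Qed.

Lemma dual3 x y z : x \in I -> y \in I -> z \in I -> li3 x y z ->
  exists p, [/\ p \in I, dot p x = 1, dot p y = 0 & dot p z = 0].
Proof.
move=> hx hy hz h; have [p1 [ip1 p1z p1y]] := dual2 hz hy (li2_sym (li3_23 h)).
have [||q [iq e qy]] := @dual2 (x - dot p1 x *: z) y _ hy; first by auto.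
  move=> a b; rewrite scalerBr scalerA addrAC -scaleNr => /h[a0 b0 _].
  by split.
move: e; rewrite dotDr dotNr dotZr => e.
exists (q - dot q z *: p1); split; auto; rewrite dotDl dotNl dotZl.
- by rewrite mulrC e.
- by rewrite p1y qy mulr0 subrr.
- by rewrite p1z mulr1 subrr.
Qed.

(** Two vectors in one eigenspace of [q, -], for a nonzero eigenvalue c, are
    dependent as soon as they commute.  The form pairs this eigenspace with the
    one of -c.  For p in the latter, [p, w] = (<p, w> / c) q, and expanding
    [v, [p, w]] in two ways gives <p, w> v = <p, v> w.  An arbitrary p is reduced
    to this case by projecting it, up to a scalar, to the eigenspace of -c.  (Over
    the complex numbers the eigenspaces are dual 3-spaces, exchanged by the
    cross product of vectors.) *)
Lemma eigen_cross c q v w : q \in I -> v \in I -> w \in I -> c != 0 ->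
  cross q v = c *: v -> cross q w = c *: w -> cross v w = 0 ->
  forall p, p \in I -> dot p w *: v = dot p v *: w.
Proof.
move=> iq iv iw c0 qv qw vw.
have eig0 d x : d != 0 -> cross q x = d *: x -> dot q x = 0.
  move=> d0 e; have := dot_cross_l q x; rewrite e dotZr => /eqP.
  by rewrite mulf_eq0 (negPf d0) => /eqP.
have qv0 := eig0 _ _ c0 qv; have qw0 := eig0 _ _ c0 qw.
have vw0 : dot v w = 0.
  apply: (mulfI c0); rewrite -dotZr -qw (cross_anti w q) dotNr -cross_skew (cross_anti v w) vw.
  by rewrite oppr0 dot_sym dot0r mulr0.
have key p : p \in I -> cross q p = - c *: p -> dot p w *: v = dot p v *: w.
  move=> ip qp; have qp0 : dot q p = 0 by apply: (eig0 (- c)); rewrite ?oppr_eq0.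
  have E1 := cross_cross iq ip iw; rewrite qw qw0 qp0 mulr0 !scale0r subr0 add0r crossZr in E1.
  have E2 := cross_cross iq iw ip.
  rewrite (cross_anti p w) qp qp0 qw0 mulr0 !scale0r subr0 add0r in E2.
  rewrite crossNr scaleNr crossNr crossZr in E2.
  rewrite (cross_anti p w) scalerN opprK dot_sym in E2.
  have E3 : c *: cross p w = dot p w *: q.
    apply: (scalerI (two_neq0 R)); rewrite !scaler_nat !mulr2n -{1}E1 -E2.
    by rewrite addrACA subrr add0r.
  have E4 := cross_cross iv ip iw.
  rewrite vw cross0r vw0 scale0r addr0 add0r in E4.
  have e : dot p w *: - (c *: v) = c *: - (dot p w *: v).
    by rewrite !scalerN !scalerA mulrC.
  have := congr1 (cross v) E3; rewrite !crossZr E4 (cross_anti q v) qv e => /(scalerI c0)/eqP.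
  rewrite -scalerA subr_eq addrC -subr_eq opprK -mulr2n -scaler_nat.
  by move=> /eqP/(scalerI (two_neq0 R)) ->; rewrite dot_sym.
have [-> p ip | v0] := eqVneq v 0; first by rewrite scaler0 dot0r scale0r.
(* As [q, [q, v]] = - <q, q> v, the eigenvalue is a square root of - <q, q>. *)
have cc : c * c = - dot q q.
  have := cross_sq iq iv; rewrite qv0 scale0r add0r qv crossZr qv scalerA -scaleNr => /eqP.
  by rewrite -subr_eq0 -scalerBl scaler_eq0 (negPf v0) orbF subr_eq0 => /eqP.
(* [p'] is the projection of [p] to the eigenspace of -c, times -2 c ^+ 2. *)
move=> p ip; pose s := cross q p; pose p' := c *: s - cross q s.
have is_ : s \in I by exact: cross_im.
have qqs : cross q (cross q s) = (c * c) *: s.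
  by rewrite cross_sq // dot_cross_l scale0r add0r cc scaleNr.
have ip' : p' \in I by rewrite /p'; auto.
have qp' : cross q p' = - c *: p'.
  rewrite /p' crossDr crossNr crossZr qqs -/s.
  by rewrite scaleNr scalerBr opprB scalerA.
have dotp' x : cross q x = c *: x -> dot p' x = - (2 * (c * c)) * dot p x.
  move=> qx; rewrite /p' dotDl dotNl dotZl (cross_skew q s) qx dotZr /s cross_skew qx dotZr.
  ring.
have c20 : - (2 * (c * c)) != 0 by rewrite oppr_eq0 !mulf_neq0 // two_neq0.
by have := key p' ip' qp'; rewrite !dotp' // -!scalerA => /(scalerI c20).
Qed.

Lemma cross0_isotropic u v : u \in I -> v \in I -> li2 u v -> cross u v = 0 ->
  dot u u = 0 /\ dot u v = 0.
Proof.
move=> iu iv h uv; have := cross_sq iu iv; rewrite uv cross0r => /esym.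
by rewrite -scaleNr => /h[-> /eqP]; rewrite oppr_eq0 => /eqP->.
Qed.

(** Choose p dual to u and orthogonal to v and w, and put q = [p, u].  Then v and
    w are eigenvectors of [q, -] for the eigenvalue -1, and [eigen_cross] applies.
    So a subspace of I with zero product has dimension at most two. *)
Lemma null_dim u v w : u \in I -> v \in I -> w \in I ->
  cross u v = 0 -> cross u w = 0 -> cross v w = 0 -> ~ li3 u v w.
Proof.
move=> iu iv iw uv uw vw h; have [p [ip pu pv pw]] := dual3 iu iv iw h.
have null x : x \in I -> cross u x = 0 -> dot p x = 0 -> li2 u x -> cross (cross p u) x = -1 *: x.
  move=> ix ux px hx; have [_ ux0] := cross0_isotropic iu ix hx ux.
  have := cross_cross ix ip iu; rewrite (cross_anti u x) ux oppr0 cross0r addr0 pu scale1r.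
  rewrite !(dot_sym x) ux0 px mulr0 !scale0r subr0 add0r => e.
  by rewrite cross_anti e scaleN1r.
have uv_li := li3_12 h; have uw_li := li2_sym (li3_12 (li3_rot (li3_rot h))).
have vw_li := li3_23 h.
have [r ir rv] := dual1 iv (li2_neq0 vw_li).
have := eigen_cross (cross_im p u) iv iw _ (null v iv uv pv uv_li) (null w iw uw pw uw_li) vw ir.
rewrite oppr_eq0 oner_eq0 => /(_ isT); rewrite rv scale1r => e.
have [|_ /eqP] := vw_li (dot r w) (-1); first by rewrite e scaleN1r subrr.
by rewrite oppr_eq0 oner_eq0.
Qed.

End Cross.

(** * Associative planes are generated by two elements *)
Section Generation.
Variable R : realType.
Local Notation C := (R[i])%C.
Local Notation O := (octonion R).
Local Notation I := (@imO R).
Implicit Types (x y z p q u v w : O) (a b c k : C) (W : {vspace O}).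
Hint Resolve cross_im imOD imOZ imON imOB : core.

Definition generated W := exists x y,
  [/\ x \in W, y \in W, cross x y \in W & li3 x y (cross x y)].

Section Fixed.
Variable W : {vspace O}.
Hypothesis dW : \dim W = 3%N.
Hypothesis WI : {subset W <= I}.
Hypothesis WE : forall x y z, x \in W -> y \in W -> z \in W ->
  cross x (cross y z) = dot x z *: y - dot x y *: z.

(** Let y, z span the orthogonal of x in W.  By hypothesis [x, [y, z]] = 0, so
    [y, z] is a multiple of x.  If it is nonzero, y and z generate.  Otherwise
    [null_dim] forces [x, -] to preserve <y, z>, and by [eigen_cross] it is not a
    scalar there; so some u in <y, z> is independent of [x, u], and x, u
    generate. *)
Lemma nonisotropic_generated x : x \in W -> dot x x != 0 -> generated W.
Proof.
move=> xW xx; have x0 : x != 0 by apply: contraNneq xx => ->; rewrite dot0r.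
have [y1 [z1 [y1W z1W li1]]] := extend1 dW xW x0.
pose orth y := y - (dot x y / dot x x) *: x.
have xorth y : dot x (orth y) = 0 by rewrite dotDr dotNr dotZr divfK // subrr.
have orthW y : y \in W -> orth y \in W by move=> yW; rewrite memvB ?memvZ.
have [y [z [yW zW li [xy xz]]]] : exists y z,
    [/\ y \in W, z \in W, li3 x y z & dot x y = 0 /\ dot x z = 0].
  by exists (orth y1), (orth z1); split; [exact: orthW|exact: orthW|exact: li3_shear|].
have ix := WI xW; have iy := WI yW; have iz := WI zW.
have liyz := li3_23 li.
have [yz | yz] := eqVneq (cross y z) 0; last first.
  have [k e] : exists k, cross y z = k *: x.
    exists ((dot x (cross y z)) / dot x x).
    have := cross_sq ix (cross_im y z); rewrite (WE xW yW zW) xy xz !scale0r subr0 cross0r.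
    move/esym/eqP; rewrite subr_eq0 => /eqP e; apply: (scalerI xx).
    by rewrite -e scalerA mulrCA divff // mulr1.
  have k0 : k != 0 by apply: contraNneq yz => k0; rewrite e k0 scale0r.
  exists y, z; split=> //; rewrite e ?memvZ // => a b c.
  rewrite scalerA => /(li3_rot li)[-> -> /eqP].
  by rewrite mulf_eq0 (negPf k0) orbF => /eqP ->.
have [yy yz0] := cross0_isotropic iy iz liyz yz.
have zy : cross z y = 0 by rewrite cross_anti yz oppr0.
have [zz _] := cross0_isotropic iz iy (li2_sym liyz) zy.
have stab w : w \in W -> dot x w = 0 -> dot y w = 0 -> dot z w = 0 ->
    exists a b, cross x w = a *: y + b *: z.
  move=> wW xw yw zw.
  have yxw : cross y (cross x w) = 0 by rewrite WE // yw dot_sym xy !scale0r subrr.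
  have zxw : cross z (cross x w) = 0 by rewrite WE // zw dot_sym xz !scale0r subrr.
  apply/span2P/negPn/negP => /(li3_nspan liyz).
  exact: null_dim iy iz (cross_im x w) yz yxw zxw.
have zy0 : dot z y = 0 by rewrite dot_sym.
have [a [b xy_ab]] := stab y yW xy yy zy0.
have [c [d xz_cd]] := stab z zW xz yz0 zz.
(* It remains to find [u] in <y, z> which is not an eigenvector of [x, -]. *)
have uses u : u \in W -> cross x u \in W -> dot x u = 0 -> li2 u (cross x u) -> generated W.
  move=> uW xuW xu liu; exists x, u; split=> // e f g h.
  have := congr1 (dot x) h; rewrite !dotDr !dotZr xu dot_cross_l !mulr0 !addr0 dot0r.
  move/eqP; rewrite mulf_eq0 (negPf xx) orbF => /eqP e0.
  by move: h; rewrite e0 scale0r add0r => /liu[].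
have ab_W a' b' : a' *: y + b' *: z \in W by rewrite memvD ?memvZ.
have [b0 | b0] := eqVneq b 0; last first.
  apply: (uses y) => //; rewrite xy_ab // => e f.
  rewrite scalerDr !scalerA addrA -scalerDl => /liyz[+ /eqP].
  rewrite mulf_eq0 (negPf b0) orbF => + /eqP f0.
  by rewrite f0 mul0r addr0.
have [c0 | c0] := eqVneq c 0; last first.
  apply: (uses z) => //; rewrite xz_cd // => e f.
  rewrite scalerDr !scalerA addrCA -scalerDl => /liyz[/eqP].
  rewrite mulf_eq0 (negPf c0) orbF => /eqP f0.
  by rewrite f0 mul0r addr0.
rewrite b0 scale0r addr0 in xy_ab; rewrite c0 scale0r add0r in xz_cd.
have sq w k : w \in I -> w != 0 -> dot x w = 0 -> cross x w = k *: w -> k * k = - dot x x.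
  move=> iw w0 xw e; have := cross_sq ix iw; rewrite xw scale0r add0r e crossZr e scalerA -scaleNr.
  by move/eqP; rewrite -subr_eq0 -scalerBl scaler_eq0 (negPf w0) orbF subr_eq0 => /eqP.
have y0 := li2_neq0 liyz; have z0 := li2_neq0 (li2_sym liyz).
have aa := sq y a iy y0 xy xy_ab.
have a0 : a != 0.
  by apply: contraNneq xx => a0; rewrite -oppr_eq0 -aa a0 mulr0.
(* Now [y] and [z] are eigenvectors of [x, -] for [a] and [d]: equality is excluded
   by [eigen_cross], and otherwise [y + z] is no eigenvector. *)
have [ad | ad] := eqVneq a d.
  have [p ip py] := dual1 iy y0.
  rewrite -ad in xz_cd; have := eigen_cross ix iy iz a0 xy_ab xz_cd yz ip.
  rewrite py scale1r => e; have [|_ /eqP] := liyz (dot p z) (-1).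
    by rewrite scaleN1r e subrr.
  by rewrite oppr_eq0 oner_eq0.
have xyz : cross x (y + z) = a *: y + d *: z by rewrite crossDr xy_ab xz_cd.
apply: (uses (y + z)); rewrite ?memvD // ?xyz // ?dotDr ?xy ?xz ?addr0 //.
move=> e f; rewrite !scalerDr !scalerA addrACA -!scalerDl => /liyz[ef1 ef2].
have /eqP : f * (a - d) = 0 by rewrite mulrBr -[f * a](addKr e) -[f * d](addKr e) ef1 ef2 subrr.
rewrite mulf_eq0 subr_eq0 (negPf ad) orbF => /eqP f0.
by move: ef1; rewrite f0 mul0r addr0.
Qed.

(** By [null_dim] some y, z in W have s = [y, z] nonzero, and s commutes with all
    of W.  Suppose that s is outside of W = <y, z, x>.  Since [x, y] commutes with
    s and y, it lies in <y, s> by [null_dim]; since it commutes with x as well, it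
    is a multiple al s of s.  Then y, x + al z and s commute pairwise and are
    independent, contradicting [null_dim]. *)
Lemma isotropic_generated : (forall x, x \in W -> dot x x = 0) -> generated W.
Proof.
move=> iso.
have iso2 x y : x \in W -> y \in W -> dot x y = 0.
  move=> xW yW; have := iso (x + y) (memvD xW yW).
  rewrite dotDl !dotDr !iso // add0r addr0 (dot_sym y x) -mulr2n -mulr_natl => /eqP.
  by rewrite mulf_eq0 (negPf (two_neq0 R)) => /eqP.
have ann x y z : x \in W -> y \in W -> z \in W -> cross x (cross y z) = 0.
  by move=> xW yW zW; rewrite WE // !iso2 // !scale0r subrr.
have [y [z [yW zW yz]]] : exists y z, [/\ y \in W, z \in W & cross y z != 0].
  have [u [v [w [uW vW wW li]]]] := extend0 dW.
  have [uv | uv] := eqVneq (cross u v) 0; last by exists u, v.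
  have [uw | uw] := eqVneq (cross u w) 0; last by exists u, w.
  have [vw | vw] := eqVneq (cross v w) 0; last by exists v, w.
  by case: (null_dim (WI uW) (WI vW) (WI wW) uv uw vw).
have iy := WI yW; have iz := WI zW; pose s := cross y z.
have is_ : s \in I by exact: cross_im.
have y0 : y != 0 by apply: contraNneq yz => ->; rewrite cross0l.
have ys : cross y s = 0 by exact: ann. have zs : cross z s = 0 by exact: ann.
have sy : cross s y = 0 by rewrite cross_anti ys oppr0.
have liyz : li2 y z.
  apply: li2_nspan => // a e; move: yz; rewrite e crossZr crossxx scaler0 eqxx //.
have [sW | sW] := boolP (s \in W).
  exists y, z; split=> // a b c e.
  have b0 : b = 0.
    have := congr1 (cross y) e; rewrite !crossDr !crossZr crossxx ys !scaler0 add0r addr0 cross0r.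
    by move/eqP; rewrite scaler_eq0 (negPf yz) orbF => /eqP.
  have a0 : a = 0.
    have := congr1 (cross z) e; rewrite !crossDr !crossZr crossxx zs !scaler0 !addr0 cross0r.
    by move/eqP; rewrite cross_anti scalerN oppr_eq0 scaler_eq0 (negPf yz) orbF => /eqP.
  move: e; rewrite a0 b0 !scale0r !add0r => /eqP.
  by rewrite scaler_eq0 (negPf yz) orbF => /eqP.
have [x xW li] := extend2 dW yW zW liyz.
have ix := WI xW; pose t := cross x y.
have s_out u v : u \in W -> v \in W -> li2 u v -> li3 u v s.
  move=> uW vW liuv; apply: li3_nspan => //; apply: contra sW; apply: subvP.
  by apply/span_subvP => w; rewrite !inE => /orP[] /eqP->.
have perp_s u : u \in W -> u != 0 -> dot s u = 0.
  move=> uW u0; have := cross_sq (WI uW) is_; rewrite (ann u y z) // cross0r iso // scale0r subr0.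
  by move/esym/eqP; rewrite scaler_eq0 (negPf u0) orbF dot_sym => /eqP.
have st : cross s t = 0.
  have x0 := li2_neq0 (li3_12 (li3_rot (li3_rot li))).
  have := cross_cross is_ ix iy; rewrite sy cross0r addr0 => ->.
  by rewrite !perp_s // (iso2 x) // !scale0r mulr0 scale0r subr0 addr0.
have yt : cross y t = 0 by exact: ann.
have [al e] : exists al, t = al *: s.
  have [t0 | t0] := eqVneq t 0; first by exists 0; rewrite scale0r.
  have liys : li2 y s by apply: li3_23 (s_out z y zW yW (li2_sym liyz)).
  have : t \in <<[:: y; s]>>%VS.
    apply/negPn/negP => /(li3_nspan liys); exact: null_dim iy is_ (cross_im x y) ys yt st.
  case/span2P=> b [al e]; exists al; have := ann x x y xW xW yW.
  rewrite -/t e crossDr !crossZr (ann x y z) // scaler0 addr0 => /eqP.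
  by rewrite scaler_eq0 (negPf t0) orbF => /eqP->; rewrite scale0r add0r.
have x1W : x + al *: z \in W by rewrite memvD ?memvZ.
have yx1 : cross y (x + al *: z) = 0.
  by rewrite crossDr crossZr -/s -e /t (cross_anti x y) addNr.
have liyx1 : li2 y (x + al *: z).
  move=> a b; rewrite scalerDr scalerA addrA addrAC => /li[-> _ ->]; by [].
case: (null_dim iy (WI x1W) is_ yx1 ys _ (s_out _ _ yW x1W liyx1)).
exact: ann.
Qed.

Lemma associative_generated : generated W.
Proof.
have [[x xW xx] | h] := pselect (exists2 x, x \in W & dot x x != 0).
  exact: nonisotropic_generated xW xx.
by apply: isotropic_generated => x xW; apply/eqP/negPn/negP => xx; case: h; exists x.
Qed.

End Fixed.
End Generation.

(** * Automorphisms by Cayley-Dickson doubling *)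
Section Doubling.
Variable R : realType.
Local Notation C := (R[i])%C.
Local Notation O := (octonion R).
Local Notation D := ('M[C]_2).
Local Notation I := (@imO R).
Local Notation e := (oone R).
Implicit Types (x y z p q u v w : O) (a b c k : C) (W : {vspace O}).
Hint Resolve cross_im imOD imOZ imON imOB : core.

Lemma omulDr x y z : omul x (y + z) = omul x y + omul x z.
Proof. by coords; destruct (oc x), (oc y), (oc z); ring8. Qed.
Lemma omulDl x y z : omul (y + z) x = omul y x + omul z x.
Proof. by coords; destruct (oc x), (oc y), (oc z); ring8. Qed.
Lemma omulZr k x y : omul x (k *: y) = k *: omul x y.
Proof. by coords; destruct (oc x), (oc y); ring8. Qed.
Lemma omulZl k x y : omul (k *: x) y = k *: omul x y.
Proof. by coords; destruct (oc x), (oc y); ring8. Qed.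
Lemma omulNr x y : omul x (- y) = - omul x y.
Proof. by rewrite -scaleN1r omulZr scaleN1r. Qed.
Lemma omulNl x y : omul (- x) y = - omul x y.
Proof. by rewrite -scaleN1r omulZl scaleN1r. Qed.
Lemma omul1r x : omul x e = x.
Proof. by coords; destruct (oc x); ring8. Qed.
Lemma omul1l x : omul e x = x.
Proof. by coords; destruct (oc x); ring8. Qed.
Lemma im_sq x : x \in I -> omul x x = - onorm x *: e.
Proof.
move=> /im_re8; rewrite onormE => hx; coords; move: hx.
by destruct (oc x) => /= ->; ring8.
Qed.
Lemma im_anticomm x y : x \in I -> y \in I -> omul y x = - obilin x y *: e - omul x y.
Proof.
move=> /im_re8 + /im_re8; rewrite obilinE => hx hy; coords; move: hx hy.
by destruct (oc x), (oc y) => /= -> ->; ring8.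
Qed.
Lemma omul_im x y : x \in I -> y \in I -> obilin x y = 0 -> omul x y \in I.
Proof.
move=> ix iy; have := cross_im x y; rewrite crossE (im_anticomm ix iy) => + xy.
rewrite xy oppr0 scale0r sub0r opprK -mulr2n -scaler_nat !imOE ocZ.
by destruct (oc (omul x y)) => /=; rewrite mulf_eq0 (negPf (two_neq0 R)).
Qed.
Lemma oconj_im x : x \in I -> oconj x = - x.
Proof. by move=> /im_re8 h; rewrite oconjE h mulr0 scale0r sub0r. Qed.
Lemma oconjD x y : oconj (x + y) = oconj x + oconj y.
Proof. by coords; destruct (oc x), (oc y); ring8. Qed.
Lemma oconjZ k x : oconj (k *: x) = k *: oconj x.
Proof. by coords; destruct (oc x); ring8. Qed.
Lemma oconj1 : oconj e = e.
Proof. by coords; ring8. Qed.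
Lemma oconjK x : oconj (oconj x) = x.
Proof. by coords; destruct (oc x); ring8. Qed.
Lemma obilin_sym x y : obilin x y = obilin y x.
Proof. by rewrite !obilinE; destruct (oc x), (oc y); ring8. Qed.
Lemma obilinDr x y z : obilin x (y + z) = obilin x y + obilin x z.
Proof. by rewrite !obilinE ocD; destruct (oc x), (oc y), (oc z); ring8. Qed.
Lemma obilinZr k x y : obilin x (k *: y) = k * obilin x y.
Proof. by rewrite !obilinE ocZ; destruct (oc x), (oc y); ring8. Qed.
Lemma omul_oconj x y : omul x (oconj y) + omul y (oconj x) = obilin x y *: e.
Proof. by rewrite -oconj_mull !omul1r. Qed.

Lemma obilin_nondeg u : (forall v, obilin u v = 0) -> u = 0.
Proof.
move=> h; have iu : u \in I by rewrite inE obilin_sym h.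
apply/eqP/negPn/negP => u0; have [p _ /eqP] := dual1 iu u0.
by rewrite dot_sym /dot -lock h mulr0 eq_sym oner_eq0.
Qed.

(** The rules for multiplying with an imaginary ell orthogonal to the other
    factors, as in the Cayley-Dickson construction. *)
Section Perp.
Variables (ell A B : O).
Hypotheses (iell : ell \in I).
Hypothesis ellA : obilin A ell = 0.

Lemma perp_comm : omul A ell = omul ell (oconj A).
Proof.
have := omul_oconj A ell; rewrite ellA scale0r (oconj_im iell) (omulNr A ell).
by move/addr0_eq; rewrite opprK.
Qed.

Hypothesis ellB : obilin B ell = 0.

Lemma perp_mul_r : omul (omul A ell) B = omul (omul A (oconj B)) ell.
Proof.
have := oconj_mulr ell B A; rewrite (obilin_sym ell) ellB scale0r (oconj_im iell).
by rewrite (omulNr A ell) (omulNl _ B) => /addr0_eq; rewrite opprK.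
Qed.
End Perp.

Lemma perp_mul_l ell A B : ell \in I -> obilin A ell = 0 -> obilin B ell = 0 ->
  obilin (omul B A) ell = 0 -> omul A (omul B ell) = omul (omul B A) ell.
Proof.
move=> iell hA hB hBA; rewrite (perp_comm iell hB) (perp_comm iell hBA) oconjM.
have := oconj_mull A ell (oconj B); rewrite hA scale0r (oconj_im iell).
by rewrite (omulNl ell) (omulNr A) => /addr0_eq; rewrite opprK.
Qed.

Lemma perp_mul_mul ell A B : ell \in I -> onorm ell = -1 -> obilin A ell = 0 ->
  obilin (omul (oconj A) (oconj B)) ell = 0 ->
  omul (omul A ell) (omul B ell) = omul (oconj B) A.
Proof.
move=> iell nell hA hAB; have := oconj_mull (omul A ell) (oconj B) ell.
rewrite obilin_mull obilin_sym hAB scale0r oconjK oconjM (oconj_im iell) (omulNl ell).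
rewrite -(perp_comm iell hA) (omulNl _ ell) (omulNr (oconj B)) altr (im_sq iell) nell opprK.
by rewrite scale1r omul1r => /eqP; rewrite addr_eq0 opprK => /eqP.
Qed.

(** An orthonormal pair a, b of imaginary octonions satisfies the relations of the
    quaternion units i, j. *)
Section Embedding.
Variables a b d ell : O.
Hypotheses (ia : a \in I) (ib : b \in I) (iell : ell \in I).
Hypotheses (na : onorm a = 1) (nb : onorm b = 1) (nell : onorm ell = -1).
Hypothesis ab0 : obilin a b = 0.
Hypotheses (aell : obilin a ell = 0) (bell : obilin b ell = 0).
Hypotheses (abd : omul a b = d) (dell : obilin d ell = 0).

Definition quat_comb t0 t1 t2 t3 : O := t0 *: e + t1 *: a + t2 *: b + t3 *: d.

Lemma quat_combD s0 s1 s2 s3 t0 t1 t2 t3 : quat_comb s0 s1 s2 s3 + quat_comb t0 t1 t2 t3 =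
  quat_comb (s0 + t0) (s1 + t1) (s2 + t2) (s3 + t3).
Proof.
by rewrite /quat_comb !scalerDl [LHS](AC (4*4) ((1*5)*(2*6)*(3*7)*(4*8))).
Qed.
Lemma quat_combZ k t0 t1 t2 t3 :
  k *: quat_comb t0 t1 t2 t3 = quat_comb (k * t0) (k * t1) (k * t2) (k * t3).
Proof. by rewrite /quat_comb !scalerDr !scalerA. Qed.
Lemma mul_aa : omul a a = - e. Proof. by rewrite im_sq // na scaleN1r. Qed.
Lemma mul_bb : omul b b = - e. Proof. by rewrite im_sq // nb scaleN1r. Qed.
Lemma mul_ba : omul b a = - d.
Proof. by rewrite im_anticomm // ab0 oppr0 scale0r sub0r abd. Qed.
Lemma mul_ad : omul a d = - b. Proof. by rewrite -abd altl mul_aa (omulNl e) omul1l. Qed.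
Lemma mul_db : omul d b = - a. Proof. by rewrite -abd altr mul_bb (omulNr a) omul1r. Qed.
Lemma mul_bd : omul b d = a.
Proof.
by rewrite -[d]opprK -mul_ba (omulNr b) altl mul_bb (omulNl e) omul1l opprK.
Qed.
Lemma mul_da : omul d a = b.
Proof.
by rewrite -[d]opprK -mul_ba (omulNl _ a) altr mul_aa (omulNr b) omul1r opprK.
Qed.
Lemma mul_dd : omul d d = - e.
Proof.
have h : omul (omul d d) b = - b by rewrite -altl mul_db (omulNr d) mul_da.
by have := altr (omul d d) b; rewrite h mul_bb (omulNl b) mul_bb (omulNr _ e) omul1r => /oppr_inj.
Qed.

Lemma quat_combM s0 s1 s2 s3 t0 t1 t2 t3 : omul (quat_comb s0 s1 s2 s3) (quat_comb t0 t1 t2 t3) =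
  quat_comb (s0 * t0 - s1 * t1 - s2 * t2 - s3 * t3) (s0 * t1 + s1 * t0 + s2 * t3 - s3 * t2)
       (s0 * t2 - s1 * t3 + s2 * t0 + s3 * t1) (s0 * t3 + s1 * t2 - s2 * t1 + s3 * t0).
Proof.
have ha : omul a (quat_comb t0 t1 t2 t3) = quat_comb (- t1) t0 (- t3) t2.
  rewrite /quat_comb !omulDr !omulZr omul1r mul_aa abd mul_ad !scalerN !scaleNr.
  rewrite [LHS](AC (1*1*1*1) (2*1*4*3)); exact: erefl.
have hb : omul b (quat_comb t0 t1 t2 t3) = quat_comb (- t2) t3 t0 (- t1).
  rewrite /quat_comb !omulDr !omulZr omul1r mul_bb mul_ba mul_bd !scalerN !scaleNr.
  rewrite [LHS](AC (1*1*1*1) (3*4*1*2)); exact: erefl.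
have hd : omul d (quat_comb t0 t1 t2 t3) = quat_comb (- t3) (- t2) t1 t0.
  rewrite /quat_comb !omulDr !omulZr omul1r mul_da mul_db mul_dd !scalerN !scaleNr.
  rewrite [LHS](AC (1*1*1*1) (4*3*2*1)); exact: erefl.
rewrite {1}/quat_comb !omulDl !omulZl omul1l ha hb hd !quat_combZ !quat_combD.
rewrite !mulrN; exact: erefl.
Qed.

Definition quat_embed (p : D) : O := quat_comb (q0 p) (q1 p) (q2 p) (q3 p).

Lemma quat_embedD (p q : D) : quat_embed (p + q) = quat_embed p + quat_embed q.
Proof. by rewrite /quat_embed quat_combD; have [-> -> -> ->] := quatD p q. Qed.
Lemma quat_embedZ k (p : D) : quat_embed (k *: p) = k *: quat_embed p.
Proof. by rewrite /quat_embed quat_combZ; have [-> -> -> ->] := quatZ k p. Qed.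
Lemma quat_embedM (p q : D) : quat_embed (p *m q) = omul (quat_embed p) (quat_embed q).
Proof. by rewrite /quat_embed quat_combM; have [-> -> -> ->] := quatM p q. Qed.
Lemma d_im : d \in I. Proof. by rewrite -abd omul_im. Qed.
Lemma quat_embed_conj (p : D) : quat_embed (qconj p) = oconj (quat_embed p).
Proof.
rewrite /quat_embed /quat_comb; have [-> -> -> ->] := quat_conj p.
by rewrite !oconjD !oconjZ oconj1 !oconj_im ?d_im // !scalerN !scaleNr.
Qed.
Lemma quat_embed_perp (p : D) : obilin (quat_embed p) ell = 0.
Proof.
have eell : obilin e ell = 0 by apply/eqP.
rewrite /quat_embed /quat_comb obilin_sym !obilinDr !obilinZr !(obilin_sym ell) eell aell bell dell.
by rewrite !mulr0 !addr0.
Qed.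

End Embedding.

(** An embedding of the quaternions extends to the octonions, once the image of
    (0, 1) is chosen orthogonal to its range and of norm -1, the norm of (0, 1). *)
Section Double.
Variables (quat_embed : D -> O) (ell : O).
Hypothesis quat_embedD : {morph quat_embed : p q / p + q}.
Hypothesis quat_embedZ : forall k, {morph quat_embed : p / k *: p}.
Hypothesis quat_embedM : forall p q : D, quat_embed (p *m q) = omul (quat_embed p) (quat_embed q).
Hypothesis quat_embed_conj : forall p : D, quat_embed (qconj p) = oconj (quat_embed p).
Hypothesis quat_embed1 : quat_embed 1%:M = e.
Hypothesis quat_embed_perp : forall p : D, obilin (quat_embed p) ell = 0.
Hypotheses (iell : ell \in I) (nell : onorm ell = -1).

Definition double (u : O) : O := quat_embed u.1 + omul (quat_embed u.2) ell.

Lemma doubleM u v : double (omul u v) = omul (double u) (double v).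
Proof.
rewrite /double -[(omul u v).1]/(u.1 *m v.1 + qconj v.2 *m u.2).
rewrite -[(omul u v).2]/(v.2 *m u.1 + u.2 *m qconj v.1).
move: u.1 u.2 v.1 v.2 => p q r s.
have E1 : omul (quat_embed p) (omul (quat_embed s) ell) = omul (quat_embed (s *m p)) ell.
  rewrite quat_embedM; apply: perp_mul_l iell (quat_embed_perp p) (quat_embed_perp s) _.
  by rewrite -quat_embedM.
have E2 : omul (omul (quat_embed q) ell) (quat_embed r) = omul (quat_embed (q *m qconj r)) ell.
  by rewrite quat_embedM quat_embed_conj; apply: perp_mul_r iell (quat_embed_perp r).
have E3 : omul (omul (quat_embed q) ell) (omul (quat_embed s) ell) = quat_embed (qconj s *m q).
  rewrite quat_embedM quat_embed_conj; apply: perp_mul_mul iell nell (quat_embed_perp q) _.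
  by rewrite -!quat_embed_conj -quat_embedM.
rewrite (quat_embedD (p *m r)) (quat_embedD (s *m p)) omulDl (omulDr (quat_embed p + _)).
rewrite (omulDl (quat_embed r)) (omulDl (omul (quat_embed s) ell)) E1 E2 E3 -quat_embedM.
rewrite [LHS](AC (2*2) ((1*4)*(3*2))); exact: erefl.
Qed.

Lemma oconj_pair u : oconj u = (qconj u.1, - u.2).
Proof.
coords; rewrite /oc [fst _]/= [snd _]/=.
have [-> -> -> ->] := quat_conj u.1; have [-> -> -> ->] := quatN u.2; ring8.
Qed.

Lemma double_lin : linear double.
Proof.
move=> k u v; rewrite /double -[(k *: u + v).1]/(k *: u.1 + v.1).
rewrite -[(k *: u + v).2]/(k *: u.2 + v.2) !quat_embedD !quat_embedZ omulDl omulZl scalerDr.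
rewrite [LHS](AC (2*2) ((1*3)*(2*4))); exact: erefl.
Qed.

Lemma doubleZ k u : double (k *: u) = k *: double u.
Proof.
rewrite /double -[(k *: u).1]/(k *: u.1) -[(k *: u).2]/(k *: u.2) !quat_embedZ.
by rewrite omulZl scalerDr.
Qed.

Lemma doubleD u v : double (u + v) = double u + double v.
Proof. by rewrite -[u]scale1r double_lin !scale1r. Qed.

Lemma double_conj u : double (oconj u) = oconj (double u).
Proof.
rewrite oconj_pair /double -[(qconj u.1, - u.2).1]/(qconj u.1) -[(qconj u.1, - u.2).2]/(- u.2).
move: u.1 u.2 => p q.
rewrite oconjD -quat_embed_conj oconjM (oconj_im iell) (omulNl ell).
rewrite -(perp_comm iell (quat_embed_perp _)) -scaleN1r quat_embedZ scaleN1r.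
exact: (congr1 _ (omulNl _ _)).
Qed.

Lemma omul_oconj_norm u : omul u (oconj u) = onorm u *: e.
Proof. by rewrite onormE; coords; destruct (oc u); ring8. Qed.

Lemma double_fst (p : D) : double (p, 0) = quat_embed p.
Proof.
have quat_embed0 : quat_embed 0 = 0 by have := quat_embedZ 0 0; rewrite !scale0r.
have h : omul 0 ell = 0 by have := omulZl 0 0 ell; rewrite !scale0r.
by rewrite -[LHS]/(quat_embed p + omul (quat_embed 0) ell) quat_embed0 h addr0.
Qed.

Lemma double1 : double e = e.
Proof. by rewrite double_fst. Qed.

(** The norm is determined by the product and the conjugation: u u^- = N(u) 1. *)
Lemma double_norm u : onorm (double u) = onorm u.
Proof.
have := omul_oconj_norm (double u); rewrite -double_conj -doubleM omul_oconj_norm.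
rewrite doubleZ double1 => /(congr1 (@oc R)); rewrite !ocZ oc1 => -[+ _ _ _ _ _ _ _].
by rewrite !mulr1.
Qed.

(** A norm preserving linear map has its kernel in the radical of the form. *)
Lemma double_inj u : double u = 0 -> u = 0.
Proof.
move=> u0; apply: obilin_nondeg => v; rewrite /obilin -(double_norm (u + v)) -(double_norm u).
rewrite -(double_norm v) doubleD u0 add0r (onormE 0) oc0 addrAC subrr add0r.
by apply/eqP; rewrite oppr_eq0 /dot8 !mul0r !addr0 subrr.
Qed.

Lemma isG2_double : exists2 g : 'End(O), isG2 g & forall u, g u = double u.
Proof.
pose dl := GRing.isLinear.Build C O O *:%R double double_lin.
pose dL : {linear O -> O} := HB.pack double dl.
have gE u : linfun dL u = double u by rewrite lfunE.
exists (linfun dL) => //; split; last first.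
  by move=> x y; rewrite !gE doubleM.
have ker : lker (linfun dL) == 0%VS.
  apply/eqP/vspaceP => u; rewrite memv_ker memv0.
  apply/eqP/eqP => [|->]; last by rewrite linear0.
  by rewrite gE; apply: double_inj.
by exists (linfun dL)^-1%VF; [exact: lker0_lfunK | exact: lker0_lfunVK].
Qed.

End Double.
End Doubling.

(** * Planes in the orbit *)
Section Orbit.
Variable R : realType.
Local Notation C := (R[i])%C.
Local Notation O := (octonion R).
Local Notation D := ('M[C]_2).
Local Notation I := (@imO R).
Local Notation e := (oone R).
Implicit Types (x y z p q u v w : O) (a b c k : C) (W : {vspace O}).
Hint Resolve cross_im imOD imOZ imON imOB : core.

Lemma oc_sum_ebasis (k : nat -> C) :
  oc (\sum_(i < 7) k i *: (ebasis R)`_i) =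
  Oct8 0 (k 0%N) (k 1%N) (k 2%N) (k 3%N) (k 4%N) (k 5%N) (k 6%N).
Proof.
rewrite !big_ord_recl big_ord0 /=; autorewrite with octE; rewrite !oc_ebasis.
by rewrite /bump /=; ring8.
Qed.

Lemma free_ebasis : free (ebasis R).
Proof.
apply/freeP => k.
have -> : \sum_(i < 7) k i *: (ebasis R)`_i = \sum_(i < 7) k (inord i) *: (ebasis R)`_i.
  by apply: eq_bigr => i _; rewrite inord_val.
move/(congr1 (@oc R)); rewrite (oc_sum_ebasis (fun n => k (inord n))) oc0.
case=> h0 h1 h2 h3 h4 h5 h6 j; rewrite -[j]inord_val.
by case: j => -[|[|[|[|[|[|[|//]]]]]]].
Qed.

Lemma dim_W0 : \dim (W0 R) = 3%N.
Proof.
apply/eqP; rewrite -/(free _); have := free_ebasis.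
by rewrite -[X in free X](cat_take_drop 3); apply: catl_free.
Qed.

Lemma dimO : \dim {: O} = 8%N.
Proof. by rewrite dimvf. Qed.

Lemma onorm_obilin u : obilin u u = 2 * onorm u.
Proof. by rewrite obilinE onormE. Qed.

Lemma onormZ k u : onorm (k *: u) = k ^+ 2 * onorm u.
Proof.
rewrite !onormE ocZ; destruct (oc u); ring8.
Qed.

Lemma obilinZl k x y : obilin (k *: x) y = k * obilin x y.
Proof. by rewrite !(obilin_sym _ y) obilinZr. Qed.
Lemma obilinDl x y z : obilin (y + z) x = obilin y x + obilin z x.
Proof. by rewrite !(obilin_sym _ x) obilinDr. Qed.

Lemma normalize c u : c != 0 -> onorm u != 0 -> exists2 k, k != 0 & onorm (k *: u) = c.
Proof.
move=> c0 u0; exists (sqrtc (c / onorm u)).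
  apply: contraNneq c0 => k0; have := sqr_sqrtc (c / onorm u).
  by rewrite k0 expr0n => /esym/eqP; rewrite mulf_eq0 invr_eq0 (negPf u0) orbF.
by rewrite onormZ sqr_sqrtc divfK.
Qed.

(** If the orthogonal of the quaternion algebra <1, a, b, ab> were totally
    isotropic, it would be contained in the radical of the octonion norm, as
    octonions project orthogonally to it; the quaternion algebra would then be
    everything, against its dimension. *)
Lemma exists_anisotropic_perp (a b : O) : a \in I -> b \in I -> onorm a = 1 -> onorm b = 1 ->
  obilin a b = 0 -> exists ell, [/\ ell \in I, onorm ell = -1, obilin a ell = 0,
    obilin b ell = 0 & obilin (omul a b) ell = 0].
Proof.
move=> ia ib na nb ab0; have [d abd] : exists d, omul a b = d by exists (omul a b).
have id' : d \in I by rewrite -abd omul_im.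
have obil1 u : u \in I -> obilin e u = 0 by move=> iu; apply/eqP.
have ne : obilin e e = 2 by rewrite obilinE oc1 /=; ring8.
have nd : onorm d = 1.
  have := im_sq id'; rewrite (mul_dd ia ib na nb ab0 abd) scaleNr => /oppr_inj.
  by move/(congr1 (@oc R)); rewrite ocZ oc1 => -[+ _ _ _ _ _ _ _]; rewrite mulr1.
have ad0 : obilin a d = 0.
  by rewrite -abd obilin_sym obilin_mull (oconj_im ia) (omulNl a) (im_sq ia) na scaleN1r opprK
    obilin_sym obil1.
have bd0 : obilin b d = 0.
  by rewrite -abd obilin_sym obilin_mulr (oconj_im ib) (omulNr b) (im_sq ib) nb scaleN1r opprK
    obilin_sym obil1.
rewrite abd; pose basis4 : seq O := [:: e; a; b; d].
pose prj u := 2^-1 *: (obilin u e *: e + obilin u a *: a + obilin u b *: b + obilin u d *: d).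
pose perp u := [/\ obilin u e = 0, obilin u a = 0, obilin u b = 0 & obilin u d = 0].
have two0 := two_neq0 R.
have perp_prj u : perp (u - prj u).
  have := (obil1 a ia, obil1 b ib, obil1 d id').
  rewrite /perp /prj -scaleN1r !obilinDl !obilinZl !obilinDl !obilinZl.
  rewrite ne !onorm_obilin na nb nd !mulr1 !(obilin_sym a e) !(obilin_sym b e) !(obilin_sym d e).
  rewrite !(obilin_sym b a) !(obilin_sym d a) !(obilin_sym d b).
  case=> -[-> ->] ->; rewrite ab0 ad0 bd0 !mulr0 !addr0 !add0r !mulN1r.
  by split; rewrite mulrCA mulVf // mulr1 subrr.
have perp_obilin (c u : O) : perp c -> obilin c u = obilin c (u - prj u).
  case=> ce ca cb cd; have c0 : obilin c (prj u) = 0.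
    by rewrite obilinZr !obilinDr !obilinZr ce ca cb cd !mulr0 !addr0 mulr0.
  by rewrite -[in LHS](subrK (prj u) u) (obilinDr c (u - prj u)) c0 addr0.
have [c [[ce ca cb cd] nc]] : exists c : O, perp c /\ onorm c != 0.
  have [//|h] := pselect (exists c : O, perp c /\ onorm c != 0).
  have iso (c : O) : perp c -> onorm c = 0.
    by move=> pc; apply/eqP/negPn/negP => nc; apply: h; exists c.
  have perpD (c c' : O) : perp c -> perp c' -> perp (c + c').
    case=> p1 p2 p3 p4 [q1 q2 q3 q4].
    by split; rewrite obilinDl ?p1 ?p2 ?p3 ?p4 ?q1 ?q2 ?q3 ?q4 addr0.
  have zero (c : O) : perp c -> c = 0.
    move=> pc; apply: obilin_nondeg => u; rewrite perp_obilin // /obilin.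
    have pu := perp_prj u; have := perpD _ _ pc pu.
    by move: (u - prj u) pu => u' pu' pcu; rewrite !iso // !subr0.
  have : ({:O} <= <<basis4>>)%VS.
    apply/subvP => u _; rewrite -[u](subrK (prj u)) (zero _ (perp_prj u)) add0r.
    by rewrite /prj memvZ // !memvD // memvZ // memv_span // !inE eqxx ?orbT.
  move/dimvS; rewrite dimO => le8.
  by have := leq_trans le8 (dim_span basis4).
have ic : c \in I by rewrite inE obilin_sym ce.
have [|k k0 nk] := @normalize (-1) c _ nc; first by rewrite oppr_eq0 oner_eq0.
have orth u : obilin c u = 0 -> obilin u (k *: c) = 0.
  by move=> cu; rewrite obilinZr obilin_sym cu mulr0.
by exists (k *: c); split; [exact: imOZ | exact: nk | exact: orth | exact: orth | exact: orth].
Qed.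

Lemma orbit_orthonormal (a b : O) : a \in I -> b \in I -> onorm a = 1 -> onorm b = 1 ->
  obilin a b = 0 -> orbitW0 <<[:: a; b; omul a b]>>%VS.
Proof.
move=> ia ib na nb ab0; have [ell [iell nell aell bell]] := exists_anisotropic_perp ia ib na nb ab0.
have [d abd] : exists d, omul a b = d by exists (omul a b).
rewrite abd => dell; pose f := quat_embed a b d.
have fZ := quat_embedZ a b d; have [] := @isG2_double R f ell (quat_embedD a b d) fZ
  (quat_embedM ia ib na nb ab0 abd) (quat_embed_conj ia ib ab0 abd) _
  (quat_embed_perp iell aell bell dell) iell nell.
  rewrite /f /quat_embed /quat_comb; have [-> -> -> ->] := quat1 R.
  by rewrite !scale0r !addr0 scale1r.
move=> g gG gE; exists g => //; rewrite /W0 limg_span /= !gE !(double_fst _ fZ).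
rewrite /f /quat_embed /quat_comb; have [-> -> -> ->] := quat_i R; have [-> -> -> ->] := quat_j R.
by have [-> -> -> ->] := quat_k R; rewrite !scale0r !addr0 !add0r !scale1r.
Qed.

(** Orthonormalise x, y to a, b.  The product ab is a multiple of [x, y], so the
    plane <a, b, ab> is contained in <x, y, [x, y]>, and equal to it by
    dimension. *)
Lemma orbit_generated (x y : O) : x \in I -> y \in I -> obilin x x != 0 ->
  obilin x x * obilin y y - obilin x y ^+ 2 != 0 -> orbitW0 <<[:: x; y; cross x y]>>%VS.
Proof.
move=> ix iy xx gram.
pose y' := y - (obilin x y / obilin x x) *: x.
have nx : onorm x != 0 by move: xx; rewrite onorm_obilin mulf_eq0 negb_or => /andP[].
have xy' : obilin x y' = 0 by rewrite obilinDr -scaleNr obilinZr mulNr divfK ?subrr.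
have ny' : onorm y' != 0.
  have e1 : obilin x x * obilin y' y' = obilin x x * obilin y y - obilin x y ^+ 2.
    rewrite {2}/y' obilinDr -scaleNr obilinZr (obilin_sym y' x) xy' mulr0 addr0.
    rewrite obilinDl -scaleNr obilinZl mulrDr mulNr mulrN.
    by congr (_ - _); rewrite mulrA [X in X * _]mulrC divfK // expr2.
  move: gram; rewrite -e1 mulf_eq0 negb_or => /andP[_].
  by rewrite onorm_obilin mulf_eq0 negb_or => /andP[].
have iy' : y' \in I by rewrite imOB ?imOZ.
have [k k0 nk] := normalize (oner_neq0 _) nx; have [l l0 nl] := normalize (oner_neq0 _) ny'.
have ab0 : obilin (k *: x) (l *: y') = 0 by rewrite obilinZl obilinZr xy' !mulr0.
have [g gG gW] := orbit_orthonormal (imOZ k ix) (imOZ l iy') nk nl ab0.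
exists g => //; rewrite -gW; apply/esym/eqP; rewrite eqEdim; apply/andP; split; last first.
  rewrite gW limg_dim_eq ?dim_W0; first exact: (dim_span [:: x; y; cross x y]).
  have [[h gK _] _] := gG; apply/eqP; rewrite -subv0; apply/subvP => u.
  rewrite memv_cap memv_ker => /andP[_ /eqP gu].
  by rewrite memv0; apply/eqP; rewrite -(gK u) gu -[RHS](gK 0) linear0.
have xW : x \in <<[:: x; y; cross x y]>>%VS by apply: memv_span; rewrite !inE eqxx.
have yW : y \in <<[:: x; y; cross x y]>>%VS by apply: memv_span; rewrite !inE eqxx orbT.
have cW : cross x y \in <<[:: x; y; cross x y]>>%VS.
  by apply: memv_span; rewrite !inE eqxx !orbT.
apply/span_subvP => u; rewrite !inE => /or3P[] /eqP ->.
- exact: memvZ.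
- by apply: memvZ; apply: memvB => //; apply: memvZ.
have e1 : 2 *: omul (k *: x) (l *: y') = (k * l) *: cross x y.
  have : cross (k *: x) (l *: y') = (k * l) *: cross x y.
    by rewrite crossZl crossZr scalerA crossDr crossNr crossZr crossxx scaler0 subr0.
  rewrite crossE (im_anticomm (imOZ k ix) (imOZ l iy')) ab0 oppr0 scale0r sub0r opprK => <-.
  by rewrite scaler_nat mulr2n.
have := memvZ (k * l) cW; rewrite -e1 rpredZeq (negPf (two_neq0 R)); exact.
Qed.

End Orbit.

(** * Plücker coordinates and the associator *)
Section Forms.
Variables (T : zmodType) (pl : nat -> nat -> nat -> T).
Local Notation p i j k := (pl i%N j%N k%N).

(** The forms are written over any additive group, to be used for polynomials, for
    Plücker coordinates and for minors of coordinate matrices. *)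
Definition seven_forms : seq T := [::
  p 2 4 7 - p 2 5 6 - p 3 4 6 - p 3 5 7;
  p 1 5 6 - p 1 4 7 + p 3 4 5 - p 3 6 7;
  - p 2 4 5 + p 2 6 7 + p 1 4 6 + p 1 5 7;
  p 5 6 7 + p 1 2 7 - p 1 3 6 + p 2 3 5;
  - p 1 2 6 - p 4 6 7 - p 1 3 7 - p 2 3 4;
  p 4 5 7 + p 1 2 5 + p 1 3 4 - p 2 3 7;
  p 1 3 5 - p 1 2 4 - p 4 5 6 + p 2 3 6].
End Forms.

Lemma seven_forms_morph (T T' : zmodType) (f : T -> T') p :
  {morph f : x y / x + y} -> {morph f : x / - x} ->
  seven_forms (fun i j k => f (p i j k)) = map f (seven_forms p).
Proof. by move=> fD fN; rewrite /seven_forms /= !fD !fN. Qed.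

Lemma eq_seven_forms (T : zmodType) (p q : nat -> nat -> nat -> T) :
  (forall i j k, (0 < i)%N -> (i < j)%N -> (j < k)%N -> (k <= 7)%N -> p i j k = q i j k) ->
  seven_forms p = seven_forms q.
Proof. by move=> pq; rewrite /seven_forms !pq. Qed.

Section Minors.
Variable A : comNzRingType.
Implicit Types x y z : oct8 A.

Definition entry8 x (i : nat) : A :=
  let: Oct8 x0 x1 x2 x3 x4 x5 x6 x7 := x in nth 0 [:: x0; x1; x2; x3; x4; x5; x6; x7] i.

(** Index 0 of [entry8] is the coordinate of the unit 1, so the indices i, j, k of
    the imaginary coordinates run from 1 to 7. *)
Definition minor8 x y z i j k : A :=
  entry8 x i * (entry8 y j * entry8 z k - entry8 y k * entry8 z j)
  - entry8 x j * (entry8 y i * entry8 z k - entry8 y k * entry8 z i)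
  + entry8 x k * (entry8 y i * entry8 z j - entry8 y j * entry8 z i).

Lemma assoc8_forms x y z (f := seven_forms (minor8 x y z)) :
  re8 x = 0 -> re8 y = 0 -> re8 z = 0 ->
  sub8 (mul8 (mul8 x y) z) (mul8 x (mul8 y z)) =
  Oct8 0 (2 * nth 0 f 0) (2 * nth 0 f 1) (2 * nth 0 f 2) (- 2 * nth 0 f 3)
    (- 2 * nth 0 f 4) (- 2 * nth 0 f 5) (- 2 * nth 0 f 6).
Proof.
rewrite /f /seven_forms /minor8; clear f; destruct x, y, z => /= -> -> ->; ring8.
Qed.
End Minors.

Section Plucker.
Variable R : realType.
Local Notation C := (R[i])%C.
Local Notation O := (octonion R).
Local Notation I := (@imO R).
Implicit Types (x y z : O) (v : 3.-tuple O) (W : {vspace O}).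

Lemma coord_ebasis x m : x \in I -> coord (ebasis R) m x = entry8 (oc x) m.+1.
Proof.
move=> ix; have -> : x = \sum_(i < 7) entry8 (oc x) i.+1 *: (ebasis R)`_i.
  apply: oc_inj; rewrite (oc_sum_ebasis (fun i => entry8 (oc x) i.+1)).
  by move/im_re8: ix; destruct (oc x) => /= ->.
rewrite (coord_sum_free _ _ (free_ebasis R)).
rewrite (oc_sum_ebasis (fun i => entry8 (oc x) i.+1)).
by case: m => -[|[|[|[|[|[|[|//]]]]]]].
Qed.

Lemma det3_nat (f : nat -> nat -> C) : \det (\matrix_(r < 3, c < 3) f r c) =
  f 0%N 0%N * (f 1%N 1%N * f 2%N 2%N - f 1%N 2%N * f 2%N 1%N)
  - f 0%N 1%N * (f 1%N 0%N * f 2%N 2%N - f 1%N 2%N * f 2%N 0%N)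
  + f 0%N 2%N * (f 1%N 0%N * f 2%N 1%N - f 1%N 1%N * f 2%N 0%N).
Proof.
rewrite (expand_det_row _ ord0) !big_ord_recl big_ord0 /cofactor.
rewrite !det2E !mxE /= /bump /=.
rewrite (modn_small (isT : 1 < 2)%N) !addn0 !add0n -[(1 + 1)%N]/2%N; ring.
Qed.

Lemma pcoordE v i j k : {in v, forall x, x \in I} ->
  (0 < i <= 7)%N -> (0 < j <= 7)%N -> (0 < k <= 7)%N ->
  pcoord v i j k = minor8 (oc v`_0) (oc v`_1) (oc v`_2) i j k.
Proof.
move=> vI hi hj hk; pose f (r c : nat) := entry8 (oc v`_r) (nth 0%N [:: i; j; k] c).
have -> : pcoord v i j k = \det (\matrix_(r < 3, c < 3) f r c).
  rewrite /pcoord /plucker; congr (\det _); apply/matrixP => r c; rewrite !mxE.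
  rewrite coord_ebasis ?vI ?mem_tnth // (tnth_nth 0 v) /f; congr entry8.
  rewrite (tnth_nth ord0).
  by case: c => -[|[|[|//]]] ? /=; rewrite inordK; case: (i) (j) (k) hi hj hk => [|?] [|?] [|?].
by rewrite det3_nat.
Qed.

Definition forms_vanish v := forall f, f \in seven_forms (pcoord v) -> f = 0.

Definition associator x y z := omul (omul x y) z - omul x (omul y z).

Lemma forms_associator v : {in v, forall x, x \in I} ->
  forms_vanish v <-> associator v`_0 v`_1 v`_2 = 0.
Proof.
move=> vI; rewrite /forms_vanish.
have -> : seven_forms (pcoord v) = seven_forms (minor8 (oc v`_0) (oc v`_1) (oc v`_2)).
  by rewrite /seven_forms !pcoordE.
have vI' (i : 'I_3) : v`_i \in I by rewrite -tnth_nth vI ?mem_tnth.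
have := assoc8_forms (im_re8 (vI' 0)) (im_re8 (vI' 1)) (im_re8 (vI' 2%:R)).
rewrite -!ocM /sub8 -ocN -ocD => e; split=> h.
  have f0 m : (m < 7)%N -> nth 0 (seven_forms (minor8 (oc v`_0) (oc v`_1) (oc v`_2))) m = 0.
    by move=> hm; apply/h/mem_nth.
  by apply: oc_inj; rewrite e oc0 !f0 // !mulr0.
move: e; rewrite -/(associator _ _ _) h oc0.
have half (k t : C) : k != 0 -> 0 = k * t -> t = 0.
  by move=> k0 /esym/eqP; rewrite mulf_eq0 (negPf k0) => /eqP.
have two := two_neq0 R; have mtwo : - 2 != 0 :> C by rewrite oppr_eq0.
case=> /(half _ _ two) f0 /(half _ _ two) f1 /(half _ _ two) f2.
move=> /(half _ _ mtwo) f3 /(half _ _ mtwo) f4 /(half _ _ mtwo) f5 /(half _ _ mtwo) f6 f.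
rewrite !inE; do 6 ![case/predU1P => [->//|]]; by move/eqP->.
Qed.

End Plucker.

(** * The closed set of associative planes *)
Section Cayley.
Variable R : realType.
Local Notation C := (R[i])%C.
Local Notation O := (octonion R).
Local Notation I := (@imO R).
Implicit Types (x y z : O) (v : 3.-tuple O) (W : {vspace O}).

Lemma plucker_change v v' (M : 'M[C]_3) t :
  (forall r, tnth v' r = \sum_s M r s *: tnth v s) ->
  plucker v' t = \det M * plucker v t.
Proof.
move=> v'E; rewrite /plucker -det_mulmx; congr (\det _).
apply/matrixP => r s; rewrite !mxE v'E linear_sum; apply: eq_bigr => i _.
by rewrite linearZ !mxE.
Qed.

(** The factor c is the determinant of the change of basis; it is zero if [v']
    is dependent. *)
Lemma plucker_basis W v v' : basis_of W v -> {subset v' <= W} ->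
  exists c, forall t, plucker v' t = c * plucker v t.
Proof.
move=> vW v'W; exists (\det (\matrix_(r, s) coord v s (tnth v' r))) => t.
apply: plucker_change => r; rewrite {1}(coord_basis vW (v'W _ (mem_tnth _ _))).
by apply: eq_bigr => s _; rewrite mxE (tnth_nth 0 v).
Qed.

Lemma forms_vanish_basis W v v' : basis_of W v -> {subset v' <= W} ->
  forms_vanish v -> forms_vanish v'.
Proof.
move=> vW v'W vf; have [c cE] := plucker_basis vW v'W.
have e : pcoord v' = fun i j k => c * pcoord v i j k.
  by apply/funext => i; apply/funext => j; apply/funext => k; rewrite /pcoord cE.
move=> f; rewrite e (seven_forms_morph (f := *%R c)); last by move=> x; rewrite mulrN.
  by move=> /mapP[g /vf -> ->]; rewrite mulr0.
by move=> x y; rewrite mulrDr.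
Qed.

Definition assoc_subspace W :=
  forall x y z, x \in W -> y \in W -> z \in W -> associator x y z = 0.

Lemma forms_associative W v : {subset W <= I} -> basis_of W v ->
  forms_vanish v <-> assoc_subspace W.
Proof.
move=> WI vW; have vI : {in v, forall x, x \in I} by move=> x /(basis_mem vW)/WI.
split=> [vf x y z xW yW zW | aW]; last first.
  by apply/(forms_associator vI)/aW; rewrite (basis_mem vW) // mem_nth ?size_tuple.
have sub : {subset [tuple x; y; z] <= W} by move=> u; rewrite !inE => /or3P[] /eqP->.
have /forms_associator := forms_vanish_basis vW sub vf.
by apply=> u /sub/WI.
Qed.

Lemma basis_exists W : \dim W = 3%N -> exists v, basis_of W v.
Proof.
move=> dW; have := vbasisP W; move: (vbasis W); rewrite dW => v vW; by exists v.
Qed.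

Lemma incr3P i j k : (0 < i)%N -> (i < j)%N -> (j < k)%N -> (k <= 7)%N ->
  sorted ltn [seq val i | i <- [tuple inord i.-1; inord j.-1; inord k.-1 : 'I_7]].
Proof.
case: i j k => [//|i] [//|j] [//|k] _ ij jk k7.
have j7 := ltnW (leq_trans jk k7); have i7 := ltnW (leq_trans ij j7).
by rewrite /= !inordK ?andbT //; apply/andP.
Qed.

(** Triples which are not increasing are sent to the index of (1, 2, 3). *)
Definition pl_index (i j k : nat) : 'I_#|{: incr3}| :=
  enum_rank (insubd (exist (fun t : 3.-tuple 'I_7 => sorted ltn [seq val m | m <- t])
      [tuple inord 0; inord 1; inord 2] (@incr3P 1 2 3 isT isT isT isT) : incr3)
    [tuple inord i.-1; inord j.-1; inord k.-1 : 'I_7]).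

Lemma pl_indexE v i j k : (0 < i)%N -> (i < j)%N -> (j < k)%N -> (k <= 7)%N ->
  pvec v (pl_index i j k) = pcoord v i j k.
Proof.
by move=> *; rewrite /pvec /pl_index enum_rankK val_insubd incr3P.
Qed.

Definition seven_polys : seq {mpoly C[#|{: incr3}|]} :=
  seven_forms (fun i j k => 'X_(pl_index i j k)).

Lemma seven_polys_homog F : F \in seven_polys -> F \is 1.-homog.
Proof.
have hX i j k : ('X_(pl_index i j k) : {mpoly C[#|{: incr3}|]}) \is 1.-homog.
  rewrite dhomogX; apply/eqP; exact: mdeg1.
by rewrite !inE; do 6 ![case/predU1P => [->|]; first by rewrite !(rpredD, rpredN) ?hX];
  move/eqP->; rewrite !(rpredD, rpredN) ?hX.
Qed.

Lemma seven_polysE v : map (meval (pvec v)) seven_polys = seven_forms (pcoord v).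
Proof.
rewrite /seven_polys -seven_forms_morph; first last.
- exact: mevalN.
- exact: mevalD.
by apply: eq_seven_forms => *; rewrite mevalXU pl_indexE.
Qed.

Definition cayley W := Gr3 W /\ assoc_subspace W.

Lemma cayleyE W : cayley W <-> Gr3 W /\ forall v, basis_of W v -> forms_vanish v.
Proof.
split=> -[gW aW]; split=> //; have [dW WI] := gW.
  by move=> v vW; apply/(forms_associative WI vW).
have [v vW] := basis_exists dW; by apply/(forms_associative WI vW)/aW.
Qed.

Lemma cayley_closed : zariski_closed cayley.
Proof.
exists (fun F => F \in seven_polys).
  by move=> F hF; exists 1%N; exact: seven_polys_homog.
move=> W; rewrite cayleyE; split=> -[gW h]; split=> //.
  by move=> F hF v vW; apply: (h v vW); rewrite -seven_polysE map_f.
by move=> v vW f; rewrite -seven_polysE => /mapP[F hF ->]; apply: h.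
Qed.

Lemma isG2_one (g : 'End(O)) : isG2 g -> g (oone R) = oone R.
Proof.
move=> [[h gK hK] gM]; rewrite -[g (oone R)]omul1r -[X in omul _ X]hK -gM omul1l.
exact: hK.
Qed.

Lemma omul_self x : omul x x = (2 * re8 (oc x)) *: x - onorm x *: oone R.
Proof. by rewrite onormE; coords; destruct (oc x); ring8. Qed.

(** Comparing x^2 = - N(x) 1 with the quadratic equation of y = g x gives
    tr(y) y = (N(y) - N(x)) 1.  If tr(y) were nonzero, y would be a scalar, hence
    so would x, which is imaginary. *)
Lemma isG2_im (g : 'End(O)) x : isG2 g -> x \in I -> g x \in I.
Proof.
move=> gG ix; have g1 := isG2_one gG; have [[h gK hK] gM] := gG.
rewrite imOE; apply/negPn/negP => t0.
have : (2 * re8 (oc (g x))) *: g x = (onorm (g x) - onorm x) *: oone R.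
  have := omul_self (g x); rewrite -gM (im_sq ix) linearZ /= g1 => e.
  by rewrite scalerBl -scaleNr e addrC subrK.
move/(congr1 ( *:%R (2 * re8 (oc (g x)))^-1)); rewrite !scalerA mulVf; last first.
  by rewrite mulf_neq0 ?two_neq0.
rewrite scale1r; set c := _ * _ => gx.
have xc : x = c *: oone R by apply: (can_inj gK); rewrite gx linearZ /= g1.
have := im_re8 ix; rewrite xc ocZ oc1 /= mulr1 => c0.
by move: t0; rewrite gx c0 scale0r oc0 eqxx.
Qed.

Lemma W0P x : x \in W0 R -> x \in I /\ x.2 = 0.
Proof.
case/span3P=> a [b [c ->]]; split; last by rewrite /= !scaler0 !addr0.
have im3 p : re8 (oc p) = 0 -> p \in I by rewrite imOE => ->.
by rewrite !imOD // imOZ // im3 // oc_ebasis.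
Qed.

Lemma orbit_cayley W : orbitW0 W -> cayley W.
Proof.
case=> g gG ->; have [[h gK hK] gM] := gG.
have ker : (W0 R :&: lker g)%VS = 0%VS.
  apply/eqP; rewrite -subv0; apply/subvP => u; rewrite memv_cap memv_ker => /andP[_ /eqP gu].
  by rewrite memv0; apply/eqP; rewrite -(gK u) gu -[RHS](gK 0) linear0.
split; first split.
- by rewrite limg_dim_eq // dim_W0.
- by move=> _ /memv_imgP[x /W0P[ix _] ->]; exact: isG2_im.
move=> _ _ _ /memv_imgP[x /W0P[_ x2] ->] /memv_imgP[y /W0P[_ y2] ->] /memv_imgP[z /W0P[_ z2] ->].
have A : omul (omul x y) z = omul x (omul y z).
  case: x y z x2 y2 z2 => [a ?] [b ?] [c ?] /= -> -> ->.
  by rewrite /omul /= !(mulmx0, mul0mx, addr0) mulmxA.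
by rewrite /associator -(gM x y) -(gM y z) -(gM (omul x y)) -(gM x) A subrr.
Qed.

End Cayley.

(** * Polynomial curves *)
Section PolynomialFunctions.
Variable F : numFieldType.
Implicit Types f g : F -> F.

Definition poly_fun f := exists p : {poly F}, forall t, f t = p.[t].

Lemma poly_fun_ext g f : poly_fun g -> f =1 g -> poly_fun f.
Proof. by move=> [p hp] fg; exists p => t; rewrite fg. Qed.
Lemma poly_fun_cst a : poly_fun (fun=> a).
Proof. by exists a%:P => t; rewrite hornerC. Qed.
Lemma poly_fun_id : poly_fun id.
Proof. by exists 'X => t; rewrite hornerX. Qed.
Lemma poly_funD f g : poly_fun f -> poly_fun g -> poly_fun (fun t => f t + g t).
Proof. by move=> [p hp] [q hq]; exists (p + q) => t; rewrite hornerD hp hq. Qed.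
Lemma poly_funM f g : poly_fun f -> poly_fun g -> poly_fun (fun t => f t * g t).
Proof. by move=> [p hp] [q hq]; exists (p * q) => t; rewrite hornerM hp hq. Qed.
Lemma poly_funN f : poly_fun f -> poly_fun (fun t => - f t).
Proof. by move=> [p hp]; exists (- p) => t; rewrite hornerN hp. Qed.
Lemma poly_funX f n : poly_fun f -> poly_fun (fun t => f t ^+ n).
Proof. by move=> [p hp]; exists (p ^+ n) => t; rewrite horner_exp hp. Qed.
Lemma poly_fun_sum (J : Type) (r : seq J) (f : J -> F -> F) :
  (forall j, poly_fun (f j)) -> poly_fun (fun t => \sum_(j <- r) f j t).
Proof.
move=> hf; elim: r => [|j r [p IH]].
  by exists 0 => t; rewrite big_nil horner0.
by have [q hq] := hf j; exists (q + p) => t; rewrite big_cons hornerD hq IH.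
Qed.
Lemma poly_fun_prod (J : Type) (r : seq J) (f : J -> F -> F) :
  (forall j, poly_fun (f j)) -> poly_fun (fun t => \prod_(j <- r) f j t).
Proof.
move=> hf; elim: r => [|j r [p IH]].
  by exists 1 => t; rewrite big_nil hornerC.
by have [q hq] := hf j; exists (q * p) => t; rewrite big_cons hornerM hq IH.
Qed.

Lemma poly_fun_eq0 (p : {poly F}) : (forall t, p.[t] = 0) -> p = 0.
Proof.
move=> h; apply/eqP/negPn/negP => p0.
have := @max_poly_roots _ p [seq n%:R | n <- iota 0 (size p)] p0.
rewrite size_map size_iota ltnn => H; suff : false by [].
apply: H; first by apply/allP => t _; rewrite /root h.
by rewrite map_inj_uniq ?iota_uniq //; apply: Num.Theory.mulrIn; rewrite oner_eq0.
Qed.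

(** The density of the set where g is nonzero: the product f g vanishes
    identically and the ring of polynomials is integral. *)
Lemma poly_fun_generic f g t0 : poly_fun f -> poly_fun g -> g t0 != 0 ->
  (forall t, g t != 0 -> f t = 0) -> forall t, f t = 0.
Proof.
move=> [p hp] [q hq] gt0 fg t; have : p * q = 0.
  apply: poly_fun_eq0 => s; rewrite hornerM -hp -hq.
  by have [->|/fg ->] := eqVneq (g s) 0; rewrite ?mulr0 ?mul0r.
move/eqP; rewrite mulf_eq0 => /orP[/eqP p0|/eqP q0].
  by rewrite hp p0 horner0.
by move: gt0; rewrite hq q0 horner0 eqxx.
Qed.
End PolynomialFunctions.

(** * Degeneration along segments *)
Section Closure.
Variable R : realType.
Local Notation C := (R[i])%C.
Local Notation O := (octonion R).
Local Notation I := (@imO R).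
Implicit Types (x y z : O) (v : 3.-tuple O) (W : {vspace O}) (t : C).
Hint Resolve cross_im imOD imOZ imON imOB : core.

Lemma meval_scale n (F : {mpoly C[n]}) d c (u u' : 'I_n -> C) : F \is d.-homog ->
  (forall i, u' i = c * u i) -> F.@[u'] = c ^+ d * F.@[u].
Proof.
move=> /dhomogP hF uu'; rewrite !mevalE big_distrr /=.
rewrite !big_seq; apply: eq_bigr => m /hF <-; rewrite mulrCA; congr (_ * _).
rewrite -[X in c ^+ X]/(mdeg m) mdegE -prodrXr -big_split /=; apply: eq_bigr => i _.
by rewrite uu' exprMn.
Qed.

Lemma vanishes_basis W v (F : {mpoly C[#|{: incr3}|]}) d : F \is d.-homog -> basis_of W v ->
  F.@[pvec v] = 0 -> vanishes F W.
Proof.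
move=> hF vW F0 v' v'W; have sub : {subset v' <= W} by move=> x /(basis_mem v'W).
have [c hc] := plucker_basis vW sub.
by rewrite (meval_scale hF (u := pvec v) (c := c)) ?F0 ?mulr0 // => i; rewrite /pvec hc.
Qed.

Definition poly_vec (f : C -> O) := forall m, poly_fun (fun t => coord (ebasis R) m (f t)).

Lemma poly_vec_cst x : poly_vec (fun=> x).
Proof. by move=> m; apply: poly_fun_cst. Qed.
Lemma poly_vecD (f g : C -> O) : poly_vec f -> poly_vec g -> poly_vec (fun t => f t + g t).
Proof.
move=> hf hg m; have [p hp] := poly_funD (hf m) (hg m).
by exists p => t; rewrite linearD /= -hp.
Qed.
Lemma poly_vecZ (a : C -> C) (f : C -> O) : poly_fun a -> poly_vec f ->
  poly_vec (fun t => a t *: f t).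
Proof.
move=> ha hf m; have [p hp] := poly_funM ha (hf m).
by exists p => t; rewrite linearZ /= -hp.
Qed.

Lemma poly_fun_meval (f g h : C -> O) (F : {mpoly C[#|{: incr3}|]}) :
  poly_vec f -> poly_vec g -> poly_vec h ->
  poly_fun (fun t => F.@[pvec [tuple f t; g t; h t]]).
Proof.
move=> hf hg hh.
have entry r m : poly_fun (fun t => coord (ebasis R) m (tnth [tuple f t; g t; h t] r)).
  by case: r => -[|[|[|//]]] ir; [exact: hf | exact: hg | exact: hh].
suff [p hp] : poly_fun (fun t =>
    \sum_(m <- msupp F) F@_m * \prod_(i < #|{: incr3}|) pvec [tuple f t; g t; h t] i ^+ m i).
  by exists p => t; rewrite mevalE hp.
apply: poly_fun_sum => m; apply: poly_funM; first exact: poly_fun_cst.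
apply: poly_fun_prod => i; apply: poly_funX; rewrite /pvec /plucker /determinant.
apply: poly_fun_sum => s; apply: poly_funM; first exact: poly_fun_cst.
apply: poly_fun_prod => r.
by apply: poly_fun_ext (entry r _) _ => t; rewrite mxE.
Qed.

Definition seg x y t : O := (1 - t) *: x + t *: y.

Lemma poly_fun_1t : poly_fun (fun t => 1 - t).
Proof. exact: poly_funD (poly_fun_cst 1) (poly_funN (poly_fun_id _)). Qed.

Lemma poly_vec_seg x y : poly_vec (seg x y).
Proof.
by apply: poly_vecD; apply: poly_vecZ; [exact: poly_fun_1t|exact: poly_vec_cst
  |exact: poly_fun_id|exact: poly_vec_cst].
Qed.

Lemma poly_fun_obilin x y z w :
  poly_fun (fun t => obilin (seg x y t) (seg z w t)).
Proof.
have [p hp] : poly_fun (fun t => (1 - t) * ((1 - t) * obilin x z + t * obilin x w)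
   + t * ((1 - t) * obilin y z + t * obilin y w)).
  have cst := poly_fun_cst; have idf := poly_fun_id C; have neg := poly_fun_1t.
  by do ![exact: cst | exact: idf | exact: neg | apply: poly_funD | apply: poly_funM].
by exists p => t; rewrite -hp /seg obilinDl !obilinZl !obilinDr !obilinZr.
Qed.

Lemma poly_vec_cross x y z w : poly_vec (fun t => cross (seg x y t) (seg z w t)).
Proof.
have h : poly_vec (fun t => (1 - t) *: ((1 - t) *: cross x z + t *: cross x w)
   + t *: ((1 - t) *: cross y z + t *: cross y w)).
  have cst := poly_vec_cst; have idf := poly_fun_id C; have neg := poly_fun_1t.
  by do ![exact: cst | exact: idf | exact: neg | apply: poly_vecD | apply: poly_vecZ].
by move=> m; have [p hp] := h m; exists p => t; rewrite -hp /seg crossDl !crossZl !crossDr !crossZr.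
Qed.

(** Join x, y to e_1, e_2 by segments: the generic member of the resulting family
    of planes lies in the orbit, and the member at t = 0 is W. *)
Lemma generated_closure W : Gr3 W -> generated W -> Xmin W.
Proof.
move=> [dW WI] [x [y [xW yW cW li]]] Z [S Shom ZE] orbZ; apply/ZE; split=> // F SF.
have [d Fd] := Shom F SF.
pose e1 : O := (qi R, 0); pose e2 : O := (qj R, 0).
pose vt t := [tuple seg x e1 t; seg y e2 t; cross (seg x e1 t) (seg y e2 t)].
have v0W : basis_of W (vt 0).
  rewrite /vt /seg subr0 !scale1r !scale0r !addr0 basisEdim dW leqnn andbT.
  by rewrite (li3_span dW xW yW cW li).
(* The set of parameters where [orbit_generated] applies. *)
apply: (vanishes_basis Fd v0W).
pose xx t := obilin (seg x e1 t) (seg x e1 t).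
pose yy t := obilin (seg y e2 t) (seg y e2 t).
pose xy t := obilin (seg x e1 t) (seg y e2 t).
pose gram t := xx t * (xx t * yy t - xy t ^+ 2).
have e1I : e1 \in I by rewrite imOE oc_ebasis.
have e2I : e2 \in I by rewrite imOE oc_ebasis.
have gram_poly : poly_fun gram.
  have xxP : poly_fun xx by exact: poly_fun_obilin.
  have yyP : poly_fun yy by exact: poly_fun_obilin.
  have xyP : poly_fun xy by exact: poly_fun_obilin.
  exact: poly_funM xxP (poly_funD (poly_funM xxP yyP) (poly_funN (poly_funX 2 xyP))).
have gram1 : gram 1 != 0.
  have seg1 u w : seg u w 1 = w by rewrite /seg subrr scale0r scale1r add0r.
  have e11 : obilin e1 e1 = 2 by rewrite obilinE !oc_ebasis; ring8.
  have e22 : obilin e2 e2 = 2 by rewrite obilinE !oc_ebasis; ring8.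
  have e12 : obilin e1 e2 = 0 by rewrite obilinE !oc_ebasis; ring8.
  rewrite /gram /xx /yy /xy !seg1 e11 e22 e12 expr0n /= subr0.
  by rewrite !mulf_neq0 ?two_neq0.
apply: (poly_fun_generic (f := fun t => F.@[pvec (vt t)]) _ gram_poly gram1).
  by apply: poly_fun_meval; [exact: poly_vec_seg | exact: poly_vec_seg | exact: poly_vec_cross].
move=> t; rewrite /gram mulf_eq0 negb_or => /andP[xx0 g0].
have segI u w : u \in I -> w \in I -> seg u w t \in I by move=> iu iw; rewrite imOD ?imOZ.
have orb := orbit_generated (segI _ _ (WI _ xW) e1I) (segI _ _ (WI _ yW) e2I) xx0 g0.
have [[dV _] _] := orbit_cayley orb.
have [_ /(_ F SF)] := (ZE _).1 (orbZ _ orb); apply.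
by rewrite basisEdim dV leqnn andbT; exact: subvv.
Qed.

Lemma cayley_generated W : cayley W -> generated W.
Proof.
move=> [[dW WI] aW]; apply: associative_generated => // x y z xW yW zW.
have := assoc_cross (WI x xW) (WI y yW) (WI z zW).
rewrite -/(associator x y z) aW // scaler0 opprD addrA => /esym/eqP.
by rewrite subr_eq0 => /eqP.
Qed.

Lemma Xmin_cayley W : Xmin W <-> cayley W.
Proof.
split=> [h | cW]; first exact: h _ (cayley_closed R) (@orbit_cayley R).
by have [gW _] := cW; apply: generated_closure (cayley_generated cW).
Qed.

Lemma forms_vanishP v : forms_vanish v <->
  (pcoord v 2 4 7 - pcoord v 2 5 6 - pcoord v 3 4 6 - pcoord v 3 5 7 = 0) /\
  (pcoord v 1 5 6 - pcoord v 1 4 7 + pcoord v 3 4 5 - pcoord v 3 6 7 = 0) /\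
  (- pcoord v 2 4 5 + pcoord v 2 6 7 + pcoord v 1 4 6 + pcoord v 1 5 7 = 0) /\
  (pcoord v 5 6 7 + pcoord v 1 2 7 - pcoord v 1 3 6 + pcoord v 2 3 5 = 0) /\
  (- pcoord v 1 2 6 - pcoord v 4 6 7 - pcoord v 1 3 7 - pcoord v 2 3 4 = 0) /\
  (pcoord v 4 5 7 + pcoord v 1 2 5 + pcoord v 1 3 4 - pcoord v 2 3 7 = 0) /\
  (pcoord v 1 3 5 - pcoord v 1 2 4 - pcoord v 4 5 6 + pcoord v 2 3 6 = 0).
Proof.
split=> [h | [f1 [f2 [f3 [f4 [f5 [f6 f7]]]]]] f].
  have f0 m : (m < 7)%N -> nth 0 (seven_forms (pcoord v)) m = 0.
    by move=> hm; apply/h/mem_nth.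
  exact: conj (f0 0%N isT) (conj (f0 1%N isT) (conj (f0 2%N isT) (conj (f0 3%N isT)
    (conj (f0 4%N isT) (conj (f0 5%N isT) (f0 6%N isT)))))).
move=> /(nthP 0)[m hm <-].
by case: m hm => [|[|[|[|[|[|[|//]]]]]]] _; [exact: f1|exact: f2|exact: f3|exact: f4
  |exact: f5|exact: f6|exact: f7].
Qed.
End Closure.

Theorem theorem1p1 (R : realType) (W : {vspace octonion R}) :
  Xmin W <->
  Gr3 W /\
  forall v : 3.-tuple (octonion R), basis_of W v ->
  (pcoord v 2 4 7 - pcoord v 2 5 6 - pcoord v 3 4 6 - pcoord v 3 5 7 = 0) /\
  (pcoord v 1 5 6 - pcoord v 1 4 7 + pcoord v 3 4 5 - pcoord v 3 6 7 = 0) /\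
  (- pcoord v 2 4 5 + pcoord v 2 6 7 + pcoord v 1 4 6 + pcoord v 1 5 7 = 0) /\
  (pcoord v 5 6 7 + pcoord v 1 2 7 - pcoord v 1 3 6 + pcoord v 2 3 5 = 0) /\
  (- pcoord v 1 2 6 - pcoord v 4 6 7 - pcoord v 1 3 7 - pcoord v 2 3 4 = 0) /\
  (pcoord v 4 5 7 + pcoord v 1 2 5 + pcoord v 1 3 4 - pcoord v 2 3 7 = 0) /\
  (pcoord v 1 3 5 - pcoord v 1 2 4 - pcoord v 4 5 6 + pcoord v 2 3 6 = 0).
Proof.
rewrite Xmin_cayley cayleyE; split=> -[gW h]; split=> // v vW.
  by apply/forms_vanishP; apply: h.
by apply/forms_vanishP; apply: h.
Qed.
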